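(* There exist absolute constants $0<c<C$ and $n_0$ such that for every $n\ge n_0$, if $G\sim G(n,1/2)$ then $$e^{-Cn}\le \mathbb{P}(G\text{ is not even-degenerate})\le e^{-cn}.$$
   Context: $G(n,1/2)$ is the uniformly random graph on $n$ labelled vertices (each pair an edge independently with probability $1/2$). A graph $G$ on $n$ vertices is even-degenerate if there is an ordering $v_1,\dots,v_n$ of its vertices such that for each $1\le i\le n-2$, $v_i$ has an even number of neighbours in $\{v_{i+1},\dots,v_n\}$. (No parity condition is imposed on $e(G)$, and no condition on the pair $v_{n-1},v_n$.) *)

(* Defs.v *)
From Stdlib Require Import Reals.
From mathcomp Require Import all_boot perm.

Set Implicit Arguments.
Unset Strict Implicit.
Unset Printing Implicit Defensive.

Definition Kn (n : nat) : {set {set 'I_n}} := [set e : {set 'I_n} | #|e| == 2].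

(* Labelled simple graphs on 'I_n = subsets of the edge set of K_n
   (the support of G(n,1/2), each with equal probability 2^-(n choose 2)). *)
Definition graphs (n : nat) : {set {set {set 'I_n}}} := powerset (Kn n).

(* Even-degenerate: there is an ordering v_0,...,v_{n-1} (given by a permutation
   s, v_i = s i) such that for every 0-based position i <= n-3 (i.e. 1-based
   1 <= i <= n-2), v_i has an even number of neighbours among v_{i+1},...,v_{n-1}. *)
Definition even_degenerate (n : nat) (E : {set {set 'I_n}}) : bool :=
  [exists s : {perm 'I_n},
    [forall i : 'I_n, (i < n - 2)%N ==>
       ~~ odd #|[set j : 'I_n | (i < j)%N && ([set s i; s j] \in E)]| ]].

Definition prob_not_even_degenerate (n : nat) : R :=
  Rdiv (INR #|[set E in graphs n | ~~ even_degenerate E]|) (INR #|graphs n|).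

(* Main.v *)
Require Import Defs.
From Stdlib Require Import Reals Lra.
From mathcomp Require Import all_boot perm.
From mathcomp Require Import zify.

Set Implicit Arguments.
Unset Strict Implicit.
Unset Printing Implicit Defensive.

(** Lower bound: rewiring two vertices a and b turns any graph into one in which
every vertex except possibly an isolated b has odd degree; the graph is then
stuck at once, or as soon as b is removed, and the original graph is determined
by the new one and the old neighbourhoods of a and b.

Upper bound: fix a set W of about n/2 vertices, z in W, and m of order n.
Whatever set of m vertices outside W is reserved, removing greedily non-reserved
even vertices outside W from the whole graph gets stuck before only m
non-reserved ones are left with probability at most 2^-m, since every step
refreshes all parities; so most reserved sets survive and there are
exponentially many leftover sets Q outside W. Dually, growing an
even-degenerate subgraph inside W from z leaves out exponentially many
different sets P. In the order (removed, P, Q, grown), only the conditions on P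
and Q remain; they prescribe row and column parities of the bipartite graph
between Q and P, which is still random. They fail to be independent only through
the handshake parity, settled by the last edge of the grown part, and are
pairwise independent for pairs (P, Q), (P', Q') with P <> P' and Q <> Q', so
Chebyshev's inequality shows that some pair succeeds. *)

(** * Parity of degrees *)

Section SymmetricDifference.
Variable T : finType.
Implicit Types A B C : {set T}.

Definition symd A B := [set x | (x \in A) (+) (x \in B)].

Lemma in_symd A B x : (x \in symd A B) = (x \in A) (+) (x \in B).
Proof. by rewrite inE. Qed.

Lemma symdK A B : symd A (symd A B) = B.
Proof. by apply/setP=> x; rewrite !in_symd addKb. Qed.

Lemma symd_sub A B C : A \subset C -> B \subset C -> symd A B \subset C.
Proof.
move=> sAC sBC; apply/subsetP=> x; rewrite in_symd.
case: (boolP (x \in A)) => [xA _|_ xB]; [exact: (subsetP sAC) | exact: (subsetP sBC)].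
Qed.

End SymmetricDifference.

Lemma big_addb_odd (T : finType) (S : {set T}) (b : pred T) :
  \big[addb/false]_(w in S) b w = odd #|[set w in S | b w]|.
Proof.
rewrite -sum1dep_card (big_morph odd oddD (erefl _)) big_mkcondr.
by apply: eq_bigr => w _; case: (b w).
Qed.

Lemma big_addb_setU (T : finType) (A B : {set T}) (b : pred T) :
  [disjoint A & B] ->
  \big[addb/false]_(w in A :|: B) b w =
  \big[addb/false]_(w in A) b w (+) \big[addb/false]_(w in B) b w.
Proof. by move=> dAB; rewrite -bigU //; apply: eq_bigl => w; rewrite !inE. Qed.

Lemma big_addb_pred1 (T : finType) (S : {set T}) (c : T) (b : bool) :
  \big[addb/false]_(w in S) ((w == c) && b) = (c \in S) && b.
Proof.
case: b; last by rewrite andbF big1 // => w _; rewrite andbF.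
rewrite andbT; under eq_bigr do rewrite andbT.
case: (boolP (c \in S)) => [cS|cS].
  rewrite (bigD1 c) //= eqxx big1 // => w /andP[_ /negbTE ->] //.
by rewrite big1 // => w wS; apply: contraNF cS => /eqP <-.
Qed.

Lemma big_addb_sub (T : finType) (A S : {set T}) :
  A \subset S -> \big[addb/false]_(w in S) (w \in A) = odd #|A|.
Proof.
move=> sAS; rewrite big_addb_odd; congr (odd #|pred_of_set _|).
by apply/setP=> x; rewrite inE andbC; apply: andb_idr; apply: (subsetP sAS).
Qed.

Section Degrees.
Variable n : nat.
Implicit Types (E : {set {set 'I_n}}) (S A B : {set 'I_n}) (v w : 'I_n).

Definition adj E v w := [set v; w] \in E.

Definition dg E v S := \big[addb/false]_(w in S) adj E v w.

Definition par E S := odd #|[set e in E | e \subset S]|.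

Lemma adjC E v w : adj E v w = adj E w v.
Proof. by rewrite /adj setUC. Qed.

Lemma adjnn E v : E \subset Kn n -> adj E v v = false.
Proof.
move=> sE; apply: contraTF isT => /(subsetP sE).
by rewrite inE setUid cards1.
Qed.

Lemma adj_symd E F v w : adj (symd E F) v w = adj E v w (+) adj F v w.
Proof. exact: in_symd. Qed.

Lemma dg_symd E F v S : dg (symd E F) v S = dg E v S (+) dg F v S.
Proof. by rewrite -big_split; apply: eq_bigr => w _; rewrite adj_symd. Qed.

Lemma dgU E v A B : [disjoint A & B] -> dg E v (A :|: B) = dg E v A (+) dg E v B.
Proof. exact: big_addb_setU. Qed.

Lemma dg0 E v : dg E v set0 = false.
Proof. exact: big_set0. Qed.

Lemma dg1 E v w : dg E v [set w] = adj E v w.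
Proof. exact: big_set1. Qed.

Lemma dgD1 E v S : E \subset Kn n -> dg E v (S :\ v) = dg E v S.
Proof.
move=> sE; case: (boolP (v \in S)) => vS; last by rewrite (setDidPl _) // disjoint_sym disjoints1.
by rewrite {2}/dg (big_setD1 v vS) /= adjnn.
Qed.

Lemma set2_inj v w w' : [set v; w] = [set v; w'] -> w = w'.
Proof.
move=> eq2; have := set22 v w'; rewrite -eq2 !inE => /orP[/eqP w'v|/eqP //].
have := set22 v w; rewrite eq2 !inE => /orP[/eqP wv|/eqP //].
by rewrite wv w'v.
Qed.

Lemma par_setU1 E v S : E \subset Kn n -> v \notin S ->
  par E (v |: S) = par E S (+) dg E v S.
Proof.
move=> sE vS; rewrite /par /dg big_addb_odd.
rewrite -(card_imset [set w in S | adj E v w] (@set2_inj v)) -oddD -cardsUI.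
rewrite (_ : _ :&: _ = set0) ?cards0 ?addn0; last first.
  apply/setP=> e; rewrite !inE; apply/negbTE/negP=> /andP[/andP[_ eS]].
  case/imsetP=> w _ ee; move: eS; rewrite ee subUset sub1set => /andP[vS' _].
  by rewrite vS' in vS.
congr (odd #|pred_of_set _|); apply/setP=> e; rewrite !inE.
apply/idP/idP=> [/andP[eE eS]|/orP[/andP[-> eS]|/imsetP[w]]]; [apply/orP| |].
- case: (boolP (v \in e)) => ve; [right|left].
    have: e \in Kn n by exact: (subsetP sE).
    rewrite [e \in Kn n]inE => /cards2P[a [b [nab ee]]].
    move: ve; rewrite ee !inE => /orP[]/eqP vE.
      apply/imsetP; exists b; last by rewrite -vE.
      rewrite inE /adj vE -ee eE andbT.
      have: b \in v |: S by apply: (subsetP eS); rewrite ee set22.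
      by rewrite !inE vE eq_sym (negbTE nab).
    apply/imsetP; exists a; last by rewrite vE setUC.
    rewrite inE /adj vE setUC -ee eE andbT.
    have: a \in v |: S by apply: (subsetP eS); rewrite ee set21.
    by rewrite !inE vE (negbTE nab).
  rewrite eE; apply/subsetP=> x xe; have := subsetP eS x xe.
  by rewrite !inE => /orP[/eqP xv|//]; by rewrite -xv xe in ve.
- by apply: subset_trans eS _; apply: subsetUr.
- rewrite inE => /andP[wS awv] ->; rewrite [_ \in E]awv /=.
  by rewrite setUS // sub1set.
Qed.

Lemma par1 E v : E \subset Kn n -> par E [set v] = false.
Proof.
move=> sE; have := @par_setU1 E v set0 sE; rewrite setU0 inE dg0 addbF => -> //.
rewrite /par (_ : [set e in E | _] = set0) ?cards0 //.
apply/setP=> e; rewrite !inE subset0; apply/negbTE/negP=> /andP[eE /eqP e0].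
by have := subsetP sE _ eE; rewrite inE e0 cards0.
Qed.

Definition mkg (r : rel 'I_n) : {set {set 'I_n}} :=
  [set e in Kn n | [exists v, exists w, (e == [set v; w]) && r v w]].

Lemma mkg_sub r : mkg r \subset Kn n.
Proof. by apply/subsetP=> e; rewrite inE => /andP[]. Qed.

Lemma adj_mkg r v w : symmetric r -> irreflexive r -> adj (mkg r) v w = r v w.
Proof.
move=> rs ri; rewrite /adj !inE cards2; apply/andP/idP=> [[_]|rvw].
  case/existsP=> a /existsP[b /andP[/eqP e2 rab]].
  have := set21 v w; rewrite e2 !inE => /orP[]/eqP vE.
    by move: e2; rewrite vE => /set2_inj ->.
  by move: e2; rewrite vE [[set a; b]]setUC => /set2_inj ->; rewrite rs.
split; last by apply/existsP; exists v; apply/existsP; exists w; rewrite eqxx.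
have -> //: v != w by apply: contraTneq rvw => ->; rewrite ri.
Qed.

End Degrees.

(** * Greedy removal *)

Section Greedy.
Variables (G T : finType) (Om : {set G}) (bit : G -> {set T} -> T -> bool).
Variables (D S0 : {set T}).

Definition gpick E S := [pick x in S :\: D | bit E S x].

Definition gstep E S := if gpick E S is Some x then S :\ x else S.

Definition gtraj E i := iter i (gstep E) S0.

Fixpoint galive E i :=
  if i is k.+1 then galive E k && (gpick E (gtraj E k) != None) else true.

Lemma galiveS E i : galive E i.+1 ->
  exists x, [/\ galive E i, x \in gtraj E i :\: D, bit E (gtraj E i) x &
                gtraj E i.+1 = gtraj E i :\ x].
Proof.
rewrite /= => /andP[al]; rewrite {1}/gstep /gpick.
case: pickP => [x /andP[xS bx] _|//].
by exists x; split=> //; rewrite /gstep /gpick; case: pickP.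
Qed.

Lemma gtrajS_sub E i : gtraj E i.+1 \subset gtraj E i.
Proof. by rewrite /= /gstep; case: gpick => [x|//]; apply: subsetDl. Qed.

Lemma gtraj_sub E i k : k <= i -> gtraj E i \subset gtraj E k.
Proof.
elim: i => [|i IHi]; first by rewrite leqn0 => /eqP ->.
rewrite leq_eqVlt => /orP[/eqP -> //|]; rewrite ltnS => /IHi.
exact/subset_trans/gtrajS_sub.
Qed.

Lemma gtraj_res E i : D \subset S0 -> D \subset gtraj E i.
Proof.
move=> sD; elim: i => [//|i IHi]; rewrite /= /gstep /gpick.
case: pickP => [x /andP[]|//]; rewrite !inE => /andP[xD _] _.
by rewrite subsetD1 IHi.
Qed.

Lemma galive_card E i : galive E i -> #|gtraj E i :\: D| + i = #|S0 :\: D|.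
Proof.
elim: i => [|i IHi] al; first by rewrite addn0.
have [x [ali xS _ ->]] := galiveS al; rewrite -(IHi ali) addnS.
rewrite (cardsD1 x (gtraj E i :\: D)) xS add1n addSn; congr (#|pred_of_set _| + i).+1.
by apply/setP=> y; rewrite !inE; do !case: (_ \in _); rewrite ?andbF ?andbT.
Qed.

Lemma gpick_congr E F S : {in S :\: D, bit E S =1 bit F S} -> gpick E S = gpick F S.
Proof.
move=> EF; rewrite /gpick.
rewrite (eq_pick (Q := fun x => (x \in S :\: D) && bit F S x)) // => x.
by case: (boolP (x \in _)) => //= /EF.
Qed.

Lemma gstep_congr E F S : {in S :\: D, bit E S =1 bit F S} -> gstep E S = gstep F S.
Proof. by move=> EF; rewrite /gstep (gpick_congr EF). Qed.

Lemma gtraj_congr E F i :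
  (forall k, k < i -> {in gtraj E k :\: D, bit E (gtraj E k) =1 bit F (gtraj E k)}) ->
  gtraj F i = gtraj E i /\ galive F i = galive E i.
Proof.
elim: i => [//|i IHi] H /=; have [|-> ->] := IHi.
  by move=> k ki; apply: H; apply: ltnW.
by rewrite (gstep_congr (H i _)) // (gpick_congr (H i _)).
Qed.

(* [tog S' S A] flips the bits of the candidates in [A] at the current state
   [S], whose predecessor is [S'], without changing the history. *)
Variable tog : {set T} -> {set T} -> {set T} -> G -> G.
Hypothesis togK : forall S' S A, involutive (tog S' S A).
Hypothesis tog_in : forall S' S A E, E \in Om -> tog S' S A E \in Om.
Hypothesis tog_old : forall E i (A : {set T}) k,
  E \in Om -> galive E i -> A \subset gtraj E i :\: D -> k < i ->
  {in gtraj E k :\: D, bit E (gtraj E k)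
    =1 bit (tog (gtraj E i.-1) (gtraj E i) A E) (gtraj E k)}.
Hypothesis tog_new : forall E i (A : {set T}) x,
  E \in Om -> galive E i -> A \subset gtraj E i :\: D -> x \in gtraj E i :\: D ->
  bit (tog (gtraj E i.-1) (gtraj E i) A E) (gtraj E i) x =
  bit E (gtraj E i) x (+) (x \in A).

Definition gstuck i :=
  [set E in Om | galive E i && (gpick E (gtraj E i) == None)].

Definition gdead i := [set E in Om | ~~ galive E i].

Lemma card_gstuck i : #|gstuck i| * 2 ^ (#|S0 :\: D| - i) <= #|Om|.
Proof.
pose prs := [set p : G * {set T} | (p.1 \in gstuck i) && (p.2 \subset gtraj p.1 i :\: D)].
have -> : #|gstuck i| * 2 ^ (#|S0 :\: D| - i) = #|prs|.
  rewrite -[#|prs|]sum1_card.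
  transitivity (\sum_(E in gstuck i) \sum_(A in powerset (gtraj E i :\: D)) 1);
    last by rewrite pair_big_dep; apply: eq_bigl => p; rewrite !inE.
  rewrite -sum_nat_const; apply: eq_bigr => E.
  rewrite inE => /and3P[_ al _]; rewrite sum1_card card_powerset.
  by congr (2 ^ _); rewrite -(galive_card al) addnK.
pose f (p : G * {set T}) := tog (gtraj p.1 i.-1) (gtraj p.1 i) p.2 p.1.
have fP (p : G * {set T}) : p \in prs -> [/\ f p \in Om, gtraj (f p) i = gtraj p.1 i,
    gtraj (f p) i.-1 = gtraj p.1 i.-1 &
    p.2 = [set x in gtraj p.1 i :\: D | bit (f p) (gtraj p.1 i) x]].
  rewrite inE => /andP[]; rewrite inE => /and3P[Om1 al1 st1] sA.
  have old := tog_old Om1 al1 sA.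
  split; first exact: tog_in.
  - by have [] := gtraj_congr (F := f p) old.
  - have [|//] := @gtraj_congr p.1 (f p) i.-1.
    by move=> k ki; apply: old; lia.
  - apply/setP=> x; rewrite inE; case: (boolP (x \in _ :\: D)) => [xS|xS] /=.
      rewrite tog_new //; move: st1; rewrite /gpick; case: pickP => // /(_ x).
      by rewrite xS /= => -> _.
    by apply: contraNF xS => /(subsetP sA).
have injf : {in prs &, injective f}.
  move=> p q pP qP fpq; have [_ t1 t1' A1] := fP p pP; have [_ t2 t2' A2] := fP q qP.
  have eqA : p.2 = q.2 by rewrite A1 A2 -t1 -t2 fpq.
  have e1 : gtraj q.1 i = gtraj p.1 i by rewrite -t1 -t2 fpq.
  have e2 : gtraj q.1 i.-1 = gtraj p.1 i.-1 by rewrite -t1' -t2' fpq.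
  move: fpq; rewrite /f -eqA e1 e2 => /(can_inj (togK _ _ _)) => e3.
  by rewrite (surjective_pairing p) (surjective_pairing q) -eqA e3.
rewrite -(card_in_imset injf); apply: subset_leq_card.
by apply/subsetP=> _ /imsetP[p /fP[? _ _ _] ->].
Qed.

Lemma card_gdead i : i <= #|S0 :\: D| -> #|gdead i| * 2 ^ (#|S0 :\: D| - i) <= #|Om|.
Proof.
elim: i => [_|i IHi ltiK].
  by rewrite (_ : gdead 0 = set0) ?cards0 //; apply/setP=> E; rewrite !inE andbF.
have sub : gdead i.+1 \subset gdead i :|: gstuck i.
  apply/subsetP=> E; rewrite !inE /= => /andP[-> /=].
  by rewrite negb_and negbK; case: galive.
have h1 := subset_leq_card sub; have h2 := leq_card_setU (gdead i) (gstuck i).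
have h3 := IHi (ltnW ltiK); have h4 := card_gstuck i.
have e2 : 2 ^ (#|S0 :\: D| - i) = 2 * 2 ^ (#|S0 :\: D| - i.+1).
  by rewrite -expnS; congr (2 ^ _); lia.
rewrite e2 in h3 h4; set K := 2 ^ _ in h3 h4 *.
have : #|gdead i.+1| * K <= (#|gdead i| + #|gstuck i|) * K.
  by rewrite leq_mul2r (leq_trans h1 h2) orbT.
by nia.
Qed.

End Greedy.

(** * Row and column sums of a random bipartite graph *)

Section SecondMoment.
Variables T1 T2 : finType.
Implicit Types (R X : {set T1 * T2}) (Q U : {set T1}) (P V : {set T2}).

Definition rsum R x P := \big[addb/false]_(y in P) ((x, y) \in R).
Definition csum R y Q := \big[addb/false]_(x in Q) ((x, y) \in R).

Lemma rsum_symd R X x P : rsum (symd R X) x P = rsum R x P (+) rsum X x P.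
Proof. by rewrite -big_split; apply: eq_bigr => y _; rewrite in_symd. Qed.

Lemma csum_symd R X y Q : csum (symd R X) y Q = csum R y Q (+) csum X y Q.
Proof. by rewrite -big_split; apply: eq_bigr => x _; rewrite in_symd. Qed.

Lemma sum_rsum_csum R Q P :
  \big[addb/false]_(x in Q) rsum R x P = \big[addb/false]_(y in P) csum R y Q.
Proof. exact: exchange_big. Qed.

(* Flips the row sums over P exactly on U and, apart from y0, the column sums
   over Q exactly on V, if x0 \in Q, y0 \in P and y0 \notin V. *)
Definition cross x0 y0 U V : {set T1 * T2} :=
  [set p | ((p.2 == y0) && (p.1 \in U)) (+)
           ((p.1 == x0) && ((p.2 \in V) (+) ((p.2 == y0) && odd #|V|)))].

Lemma rsum_cross x0 y0 U V x P : y0 \in P -> V \subset P ->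
  rsum (cross x0 y0 U V) x P = (x \in U).
Proof.
move=> y0P sVP; rewrite /rsum; under eq_bigr do rewrite inE /=.
rewrite big_split /= big_addb_pred1 y0P /=.
case: (x == x0) => /=; last by rewrite big1 ?addbF.
by rewrite big_split /= big_addb_sub // big_addb_pred1 y0P /= addbb addbF.
Qed.

Lemma rsum_cross0 x0 y0 U V x P : y0 \notin P -> x != x0 ->
  rsum (cross x0 y0 U V) x P = false.
Proof.
move=> y0P /negbTE xx0; apply: big1 => y yP; rewrite inE /= xx0 /= addbF.
by case: eqP => // yy0; rewrite -yy0 yP in y0P.
Qed.

Lemma csum_cross x0 y0 U V y Q : x0 \in Q -> y != y0 ->
  csum (cross x0 y0 U V) y Q = (y \in V).
Proof.
move=> x0Q /negbTE yy0; rewrite /csum; under eq_bigr do rewrite inE /= yy0 /= addbF.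
by rewrite big_addb_pred1 x0Q.
Qed.

Lemma csum_cross0 x0 y0 U V y Q : x0 \notin Q -> y != y0 ->
  csum (cross x0 y0 U V) y Q = false.
Proof.
move=> x0Q /negbTE yy0; apply: big1 => x xQ; rewrite inE /= yy0 /= addbF.
by case: eqP => // xx0; rewrite -xx0 xQ in x0Q.
Qed.

Variables (s : nat) (FQ : {set {set T1}}) (FP : {set {set T2}}).
Variables (u : {set T1} -> {set T2} -> T1 -> bool) (w : {set T1} -> {set T2} -> T2 -> bool).
Hypothesis s_gt0 : 0 < s.
Hypothesis FQ_card : forall Q, Q \in FQ -> #|Q| = s.
Hypothesis FP_card : forall P, P \in FP -> #|P| = s.
Hypothesis consistent : forall Q P, Q \in FQ -> P \in FP ->
  \big[addb/false]_(x in Q) u Q P x = \big[addb/false]_(y in P) w Q P y.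

Let kappa := 2 ^ (2 * s).-1.

(* The column y0 is left out because its sum is forced by [consistent]. *)
Definition defect R Q P y0 : {set T1} * {set T2} :=
  ([set x in Q | rsum R x P (+) u Q P x],
   [set y in P :\ y0 | csum R y Q (+) w Q P y]).

Definition solved R Q P :=
  [forall x in Q, rsum R x P == u Q P x] && [forall y in P, csum R y Q == w Q P y].

Lemma solvedP R Q P y0 : Q \in FQ -> P \in FP -> y0 \in P ->
  reflect (defect R Q P y0 = (set0, set0)) (solved R Q P).
Proof.
move=> FQQ FPP y0P; apply: (iffP idP) => [/andP[/forall_inP rR /forall_inP cR]|[rR cR]].
  congr (_, _); apply/setP=> z; rewrite !inE.
    by case: (boolP (z \in Q)) => //= /rR /eqP ->; rewrite addbb.
  by case: (boolP (z \in P)) => [/cR /eqP ->|_]; rewrite ?andbF // addbb andbF.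
have rR' x : x \in Q -> rsum R x P = u Q P x.
  move=> xQ; have /setP/(_ x) := rR; rewrite !inE xQ /=.
  by case: rsum; case: u.
have cR' y : y \in P -> y != y0 -> csum R y Q = w Q P y.
  move=> yP yy0; have /setP/(_ y) := cR; rewrite !inE yP yy0 /=.
  by case: csum; case: w.
apply/andP; split; apply/forall_inP; first by move=> x xQ; rewrite rR'.
move=> y yP.
have [->|yy0] := eqVneq y y0; last by rewrite cR'.
have := sum_rsum_csum R Q P; rewrite (eq_bigr _ rR') consistent //.
rewrite (big_setD1 y0) //= [RHS](big_setD1 y0) //=.
rewrite (eq_bigr (csum R ^~ Q)); last by move=> t; rewrite !inE => /andP[? ?]; rewrite cR'.
by move/addIb => ->.
Qed.

Definition cells Q P y0 := setX (powerset Q) (powerset (P :\ y0)).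

Lemma card_cells Q P y0 : Q \in FQ -> P \in FP -> y0 \in P -> #|cells Q P y0| = kappa.
Proof.
move=> FQQ FPP y0P; rewrite cardsX !card_powerset FQ_card // -expnD /kappa.
have := FP_card FPP; rewrite (cardsD1 y0) y0P => cP.
by congr (2 ^ _); lia.
Qed.

Lemma defect_cells R Q P y0 : defect R Q P y0 \in cells Q P y0.
Proof. by rewrite !inE; apply/andP; split; apply/subsetP=> z; rewrite !inE => /andP[]. Qed.

Definition xshift x0 y0 (c : {set T1} * {set T2}) R := symd (cross x0 y0 c.1 c.2) R.

Lemma xshiftK x0 y0 c : involutive (xshift x0 y0 c).
Proof. by move=> R; rewrite /xshift symdK. Qed.

Lemma defect_xshift R Q P x0 y0 c : x0 \in Q -> y0 \in P -> c \in cells Q P y0 ->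
  defect (xshift x0 y0 c R) Q P y0 =
  (symd (defect R Q P y0).1 c.1, symd (defect R Q P y0).2 c.2).
Proof.
move=> x0Q y0P; rewrite !inE => /andP[sU sV]; congr (_, _); apply/setP=> z.
  rewrite !inE rsum_symd rsum_cross //; last exact: subset_trans sV (subsetDl _ _).
  case: (boolP (z \in Q)) => zQ /=; first by rewrite -addbA addbC.
  by apply/esym; apply: contraNF zQ => /(subsetP sU).
rewrite !inE csum_symd.
case: (boolP (z == y0)) => [/eqP ->|zy0] /=.
  by apply/esym; apply: contraTF isT => /(subsetP sV); rewrite !inE eqxx.
rewrite csum_cross //; case: (boolP (z \in P)) => zP /=; first by rewrite -addbA addbC.
by apply/esym; apply: contraNF zP => /(subsetP sV); rewrite !inE => /andP[].
Qed.

Lemma defect_xshift_other R Q P x0 y0 y0' c : x0 \notin Q -> y0 \notin P ->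
  defect (xshift x0 y0 c R) Q P y0' = defect R Q P y0'.
Proof.
move=> x0Q y0P; congr (_, _); apply/setP=> z; rewrite !inE.
  case: (boolP (z \in Q)) => //= zQ; rewrite rsum_symd rsum_cross0 //.
  by apply: contraTneq zQ => ->.
case: (boolP (z \in P)) => //= zP; last by rewrite !andbF.
rewrite csum_symd csum_cross0 //.
by apply: contraTneq zP => ->.
Qed.

Lemma symd0s (T : finType) (A : {set T}) : symd set0 A = A.
Proof. by apply/setP=> x; rewrite !inE. Qed.

Lemma symdv (T : finType) (A : {set T}) : symd A A = set0.
Proof. by apply/setP=> x; rewrite !inE addbb. Qed.

Lemma card_solved Q P : Q \in FQ -> P \in FP ->
  #|[set R | solved R Q P]| * kappa = #|{set T1 * T2}|.
Proof.
move=> FQQ FPP.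
have /set0Pn[x0 x0Q] : Q != set0 by rewrite -card_gt0 FQ_card.
have /set0Pn[y0 y0P] : P != set0 by rewrite -card_gt0 FP_card.
rewrite -(card_cells FQQ FPP y0P) -cardsX -cardsT; apply/esym.
pose g R := (xshift x0 y0 (defect R Q P y0) R, defect R Q P y0).
have injg : injective g.
  move=> R R' eg; have e2 : defect R Q P y0 = defect R' Q P y0 := congr1 snd eg.
  by have := congr1 fst eg; rewrite /g [X in _ = X]/fst [X in X = _]/fst e2 => /(can_inj (xshiftK _ _ _)).
rewrite -(card_imset _ injg); apply: eq_card => -[R c]; rewrite inE /=.
apply/imsetP/andP=> [[R' _ [-> ->]]|[sR cc]].
  split; last exact: defect_cells.
  rewrite inE; apply/(solvedP _ FQQ FPP y0P).
  by rewrite defect_xshift ?defect_cells // !symdv.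
exists (xshift x0 y0 c R); rewrite ?inE // /g defect_xshift //.
move: sR; rewrite inE => /(solvedP _ FQQ FPP y0P) -> /=.
by rewrite !symd0s -surjective_pairing xshiftK.
Qed.

Lemma exists_diff (T : finType) (A B : {set T}) : #|A| = #|B| -> A != B ->
  exists2 x, x \in A & x \notin B.
Proof.
move=> cAB nAB; have /subsetPn[x xA xB] : ~~ (A \subset B); last by exists x.
by apply: contra nAB => sAB; rewrite eqEcard sAB cAB leqnn.
Qed.

Lemma card_solved2 Q P Q' P' : Q \in FQ -> P \in FP -> Q' \in FQ -> P' \in FP ->
  Q != Q' -> P != P' ->
  #|[set R | solved R Q P && solved R Q' P']| * kappa ^ 2 <= #|{set T1 * T2}|.
Proof.
move=> FQQ FPP FQ' FP' nQ nP.
have [x0 x0Q x0Q'] := exists_diff (etrans (FQ_card FQQ) (esym (FQ_card FQ'))) nQ.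
have [y0 y0P y0P'] := exists_diff (etrans (FP_card FPP) (esym (FP_card FP'))) nP.
rewrite eq_sym in nQ; rewrite eq_sym in nP.
have [x1 x1Q' x1Q] := exists_diff (etrans (FQ_card FQ') (esym (FQ_card FQQ))) nQ.
have [y1 y1P' y1P] := exists_diff (etrans (FP_card FP') (esym (FP_card FPP))) nP.
rewrite -mulnn mulnA -{1}(card_cells FQQ FPP y0P) -(card_cells FQ' FP' y1P') -!cardsX.
pose f (p : {set T1 * T2} * ({set T1} * {set T2}) * ({set T1} * {set T2})) :=
  xshift x0 y0 p.1.2 (xshift x1 y1 p.2 p.1.1).
rewrite -(@card_in_imset _ _ f); first exact: max_card.
have key p : p \in setX (setX [set R | solved R Q P && solved R Q' P']
      (cells Q P y0)) (cells Q' P' y1) ->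
    defect (f p) Q P y0 = p.1.2 /\ defect (f p) Q' P' y1 = p.2.
  case: p => [[R c] c']; rewrite /f in_setX /= => /andP[]; rewrite in_setX /= => /andP[].
  rewrite inE => /andP[/(solvedP _ FQQ FPP y0P) dR /(solvedP _ FQ' FP' y1P') dR'] cc cc'.
  split.
    by rewrite defect_xshift // defect_xshift_other // dR /= !symd0s -surjective_pairing.
  by rewrite defect_xshift_other // defect_xshift // dR' /= !symd0s -surjective_pairing.
move=> p q pS qS fpq; have [p1 p2] := key p pS; have [q1 q2] := key q qS.
have e1 : p.1.2 = q.1.2 by rewrite -p1 -q1 fpq.
have e2 : p.2 = q.2 by rewrite -p2 -q2 fpq.
move: fpq; rewrite /f e1 e2 => /(can_inj (xshiftK _ _ _)) /(can_inj (xshiftK _ _ _)) e3.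
rewrite (surjective_pairing p) (surjective_pairing q) e2; congr (_, _).
by rewrite (surjective_pairing p.1) (surjective_pairing q.1) e1 e3.
Qed.

Let I := setX FQ FP.

Let in_I i : (i \in I) = (i.1 \in FQ) && (i.2 \in FP).
Proof. by rewrite inE. Qed.

Let Z R := \sum_(i in I) solved R i.1 i.2.

Lemma card_as_sum (T : finType) (p : pred T) : \sum_(R : T) p R = #|[set R | p R]|.
Proof.
by rewrite -sum1dep_card [RHS]big_mkcond; apply: eq_bigr => R _; case: (p R).
Qed.

Lemma sum_Z : kappa * (\sum_R Z R) = #|I| * #|{set T1 * T2}|.
Proof.
rewrite exchange_big /= big_distrr /= -sum_nat_const; apply: eq_bigr => i.
rewrite in_I => /andP[Qi Pi].
by rewrite card_as_sum mulnC card_solved.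
Qed.

Lemma sum_ZZ : kappa ^ 2 * (\sum_R Z R ^ 2) <=
  #|I| ^ 2 * #|{set T1 * T2}| + kappa * #|{set T1 * T2}| * (#|I| * (#|FQ| + #|FP|)).
Proof.
set tot := #|{set T1 * T2}|.
have -> : \sum_R Z R ^ 2 =
    \sum_(i in I) \sum_(j in I) #|[set R | solved R i.1 i.2 && solved R j.1 j.2]|.
  under [RHS]eq_bigr => i _.
    under eq_bigr => j _ do rewrite -card_as_sum.
    rewrite exchange_big; over.
  rewrite exchange_big; apply: eq_bigr => R _.
  rewrite -mulnn big_distrl; apply: eq_bigr => i _.
  by rewrite big_distrr; apply: eq_bigr => j _ /=; rewrite mulnb.
have bound i j : i \in I -> j \in I ->
    kappa ^ 2 * #|[set R | solved R i.1 i.2 && solved R j.1 j.2]| <=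
    tot + kappa * tot * ((i.1 == j.1) + (i.2 == j.2)).
  rewrite !in_I => /andP[Qi Pi] /andP[Qj Pj].
  have triv : kappa ^ 2 * #|[set R | solved R i.1 i.2 && solved R j.1 j.2]| <= kappa * tot.
    rewrite /tot -(card_solved Qi Pi) -mulnn -mulnA leq_mul2l mulnC leq_mul2r.
    rewrite subset_leq_card ?orbT //.
    by apply/subsetP=> R; rewrite !inE => /andP[].
  have [e1|n1] := eqVneq i.1 j.1; first by nia.
  have [e2|n2] := eqVneq i.2 j.2; first by nia.
  by rewrite muln0 addn0 mulnC card_solved2.
rewrite big_distrr /=.
apply: (@leq_trans (\sum_(i in I) (#|I| * tot + kappa * tot * (#|FQ| + #|FP|)))); last first.
  by rewrite sum_nat_const mulnDr mulnA mulnn leq_add2l mulnCA.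
apply: leq_sum => i iI; rewrite big_distrr /=.
apply: (leq_trans (leq_sum _ (fun j jI => bound i j iI jI))).
rewrite big_split /= sum_nat_const leq_add2l -big_distrr /= leq_mul2l.
apply/orP; right; rewrite big_split /= addnC.
have iQ : i.1 \in FQ by move: iI; rewrite in_I => /andP[].
have iP : i.2 \in FP by move: iI; rewrite in_I => /andP[].
apply: leq_add.
  have -> : \sum_(j in I) (i.2 == j.2) = \sum_(Q in FQ) \sum_(P in FP) (i.2 == P).
    by rewrite pair_big_dep; apply: eq_bigl => p; rewrite in_I.
  rewrite (eq_bigr (fun => 1)) ?sum1_card // => Q _.
  by rewrite (bigD1 i.2) //= eqxx big1 // => P /andP[_ /negbTE]; rewrite eq_sym => ->.
have -> : \sum_(j in I) (i.1 == j.1) = \sum_(Q in FQ) \sum_(P in FP) (i.1 == Q).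
  by rewrite pair_big_dep; apply: eq_bigl => p; rewrite in_I.
rewrite exchange_big /= (eq_bigr (fun => 1)) ?sum1_card // => P _.
by rewrite (bigD1 i.1) //= eqxx big1 // => Q /andP[_ /negbTE]; rewrite eq_sym => ->.
Qed.

Lemma card_unsolved :
  #|[set R | ~~ [exists Q in FQ, exists P in FP, solved R Q P]]| * (#|FQ| * #|FP|)
  <= kappa * (#|FQ| + #|FP|) * #|{set T1 * T2}|.
Proof.
set Z0 := [set R | _]; set tot := #|{set T1 * T2}|; rewrite -cardsX -/I.
have Z0P R : R \in Z0 -> Z R = 0.
  rewrite inE => nR; apply: big1 => i; rewrite in_I => /andP[Qi Pi].
  apply/eqP; rewrite eqb0; apply: contra nR => sR.
  by apply/exists_inP; exists i.1 => //; apply/exists_inP; exists i.2.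
have [I0|Igt0] := posnP #|I|; first by rewrite I0 muln0.
have var : #|Z0| * #|I| ^ 2 + 2 * #|I| * (kappa * \sum_R Z R) <=
    kappa ^ 2 * (\sum_R Z R ^ 2) + tot * #|I| ^ 2.
  have -> : tot * #|I| ^ 2 = \sum_(R : {set T1 * T2}) #|I| ^ 2 by rewrite sum_nat_const.
  have -> : #|Z0| * #|I| ^ 2 = \sum_(R : {set T1 * T2}) (R \in Z0) * #|I| ^ 2.
    by rewrite -big_distrl /= card_as_sum; congr (#|pred_of_set _| * _); apply/setP=> R; rewrite !inE.
  rewrite !big_distrr -!big_split; apply: leq_sum => R _ /=.
  case: (boolP (R \in Z0)) => [/Z0P ->|_]; first by nia.
  rewrite mul0n add0n -expnMn mulnAC -mulnA mulnC mulnAC [_ * 2]mulnC -mulnA; exact: (nat_Cauchy _ _).1.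
rewrite sum_Z in var; have ZZ := sum_ZZ.
rewrite -/tot in var ZZ.
have : #|I| * (#|Z0| * #|I|) <= #|I| * (kappa * (#|FQ| + #|FP|) * tot) by nia.
by rewrite leq_pmul2l.
Qed.

End SecondMoment.

(** * Orderings *)

Section Orderings.
Variable n : nat.
Implicit Types (E : {set {set 'I_n}}) (S A B : {set 'I_n}) (v w : 'I_n) (l : seq 'I_n).

Fixpoint removable E B l :=
  if l is v :: l' then ~~ dg E v (B :|: [set x in l']) && removable E B l' else true.

Lemma set_cat l1 l2 : [set x in l1 ++ l2] = [set x in l1] :|: [set x in l2].
Proof. by apply/setP=> x; rewrite !inE mem_cat. Qed.

Lemma removable_cat E B l1 l2 :
  removable E B (l1 ++ l2) = removable E (B :|: [set x in l2]) l1 && removable E B l2.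
Proof.
elim: l1 => [//|v l1 IHl] /=; rewrite IHl andbA set_cat.
by rewrite [[set x in l1] :|: _]setUC setUA.
Qed.

Definition later l v := [set x in drop (index v l).+1 l].

Lemma later_head v l : later (v :: l) v = [set x in l].
Proof. by rewrite /later /= eqxx drop0. Qed.

Lemma later_cons v w l : v \notin l -> w \in l -> later (v :: l) w = later l w.
Proof.
move=> vl wl; rewrite /later /=; case: eqP => // vw.
by rewrite vw wl in vl.
Qed.

Lemma later_sub l v : later l v \subset [set x in l].
Proof. by apply/subsetP=> x; rewrite !inE => /mem_drop. Qed.

Lemma removableE E B l : uniq l -> removable E B l = all (fun v => ~~ dg E v (B :|: later l v)) l.
Proof.
elim: l => [//|v l IHl] /andP[vl ul] /=; rewrite later_head IHl //; congr andb.
by apply: eq_in_all => w wl; rewrite later_cons.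
Qed.

Lemma sum_dg_later E B l : E \subset Kn n -> uniq l -> [disjoint B & [set x in l]] ->
  \big[addb/false]_(v <- l) dg E v (B :|: later l v)
  = par E (B :|: [set x in l]) (+) par E B.
Proof.
move=> sE; elim: l => [|v l IHl] /=; first by rewrite big_nil set_nil setU0 addbb.
move=> /andP[vl ul]; rewrite set_cons => dB.
have dBl : [disjoint B & [set x in l]] by apply: disjointWr dB; apply: subsetUr.
have vB : v \notin B by apply/negP=> /(disjointFr dB); rewrite !inE eqxx.
rewrite big_cons later_head big_seq.
rewrite (eq_bigr (fun w => dg E w (B :|: later l w))); last first.
  by move=> w wl; rewrite later_cons.
rewrite -big_seq IHl // setUCA par_setU1 //; last by rewrite !inE negb_or vB.
by rewrite addbA [dg _ _ _ (+) _]addbC.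
Qed.

Lemma par_removable E B l : E \subset Kn n -> uniq l -> [disjoint B & [set x in l]] ->
  removable E B l -> par E (B :|: [set x in l]) = par E B.
Proof.
move=> sE ul dBl; rewrite removableE // => /allP ok.
have := sum_dg_later sE ul dBl; rewrite big_seq big1 => [|v /ok /negbTE //].
by case: (par E B); case: par.
Qed.

Lemma removable_even_degenerate E a b l : uniq (l ++ [:: a; b]) ->
  [set x in l ++ [:: a; b]] = setT -> removable E [set a; b] l -> even_degenerate E.
Proof.
set L := l ++ _ => uL LT lokl.
have sL : size L = n.
  by rewrite -(card_uniqP uL) -[RHS]card_ord -cardsT -LT cardsE.
have ul : uniq l by move: uL; rewrite cat_uniq => /and3P[].
pose f (i : 'I_n) := nth b L i.
have injf : injective f.
  move=> i j /eqP; rewrite /f nth_uniq ?sL // => /eqP; exact: val_inj.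
apply/existsP; exists (perm injf); apply/forallP=> i; apply/implyP=> lti.
have lil : i < size l by move: sL lti; rewrite size_cat /=; lia.
have fi : f i = nth b l i by rewrite /f nth_cat lil.
have: ~~ dg E (f i) ([set a; b] :|: later l (f i)).
  by move: lokl; rewrite removableE // => /allP; apply; rewrite fi mem_nth.
rewrite /later fi index_uniq // -fi /dg big_addb_odd.
rewrite -[X in _ -> ~~ odd X](card_imset _ (@perm_inj _ (perm injf))).
have -> : [set a; b] :|: [set x in drop i.+1 l] = [set x in drop i.+1 L].
  apply/setP=> x; rewrite drop_cat.
  case: ltnP => [_|le_li]; first by rewrite !inE mem_cat !inE orbC.
  have -> : i.+1 - size l = 0 by lia.
  by rewrite drop0 drop_oversize // !inE orbF.
rewrite (_ : [set w in _ | _] = [set perm injf j | j in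
  [set j : 'I_n | (i < j)%N && ([set perm injf i; perm injf j] \in E)]]) //.
apply/setP=> x; apply/idP/imsetP=> [|[j]].
  rewrite !inE => /andP[xd ax].
  have xL : x \in L by apply: mem_drop xd.
  have ltj : index x L < n by move: xL; rewrite -index_mem sL.
  exists (Ordinal ltj); last by rewrite permE /f /= nth_index.
  rewrite !inE !permE {2}/f /= nth_index // [_ \in E]ax andbT.
  move: uL; rewrite -{1}(cat_take_drop i.+1 L) cat_uniq => /and3P[_ /hasPn/(_ x xd) + _].
  by rewrite in_take_leq ?sL //= -leqNgt.
rewrite !inE => /andP[ltij]; rewrite !permE => aE ->.
rewrite [adj _ _ _]aE andbT.
have : nth b L j \in take i.+1 L ++ drop i.+1 L by rewrite cat_take_drop mem_nth ?sL.
by rewrite mem_cat in_take_leq ?sL // index_uniq ?sL // ltnS leqNgt ltij.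
Qed.

Definition fbit E S v := ~~ dg E v S.

Lemma greedy_forward_list D S0 E i : E \subset Kn n -> galive fbit D S0 E i ->
  exists l, [/\ uniq l, [set x in l] = S0 :\: gtraj fbit D S0 E i &
                removable E (gtraj fbit D S0 E i) l].
Proof.
move=> sE; elim: i => [|i IHi] al.
  by exists [::]; split=> //; rewrite set_nil setDv.
have [x [ali xS bx ->]] := galiveS al; have [l [ul sl okl]] := IHi ali.
have xS' : x \in gtraj fbit D S0 E i by move: xS; rewrite inE => /andP[].
have xl : x \notin l.
  by have /setP/(_ x) := sl; rewrite !inE xS' /= => ->.
exists (rcons l x); split; first by rewrite rcons_uniq xl.
  apply/setP=> y; rewrite inE mem_rcons inE; have /setP/(_ y) := sl; rewrite !inE => ->.
  have [->|_] /= := eqVneq y x; last by [].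
  have: x \in S0 by exact: (subsetP (gtraj_sub _ _ _ _ (leq0n i)) _ xS').
  by move=> ->.
rewrite /fbit in bx; rewrite -cats1 removable_cat /= set_nil setU0 dgD1 // bx !andbT.
have -> : gtraj fbit D S0 E i :\ x :|: [set x0 in [:: x]] = gtraj fbit D S0 E i; last by [].
by apply/setP=> y; rewrite !inE; have [->|_] := eqVneq y x; rewrite ?orbT ?xS' ?orbF.
Qed.

(* States of the backward greedy are the complements of the sets grown. *)
Definition bbit (tau : bool) E S v := dg E v (~: S) == tau && (#|~: S| == 1).

Lemma greedy_backward_list tau D z E i : E \subset Kn n ->
  galive (bbit tau) D (~: [set z]) E i.+1 ->
  exists a l, [/\ uniq (l ++ [:: a; z]),
    [set x in l ++ [:: a; z]] = ~: gtraj (bbit tau) D (~: [set z]) E i.+1,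
    removable E [set a; z] l & adj E a z = tau].
Proof.
move=> sE; elim: i => [|i IHi] al.
  have [x [_ xS + ->]] := galiveS al.
  have : x \in ~: [set z] by move: xS; rewrite inE => /andP[].
  rewrite !inE => xz; rewrite /bbit /= setCK cards1 eqxx andbT dg1 => /eqP ax.
  exists x, [::]; split=> //=; first by rewrite inE xz.
  apply/setP=> y; rewrite !inE.
  by rewrite negb_and !negbK.
have [x [ali xS]] := galiveS al; have [a [l [ul sl okl az]]] := IHi ali.
set S := gtraj _ _ _ _ _ in xS sl *.
have xS' : x \in S by move: xS; rewrite inE => /andP[].
have xl : x \notin l ++ [:: a; z].
  by have /setP/(_ x) := sl; rewrite !inE xS' /= => ->.
have nz : #|~: S| != 1.
  rewrite -sl cardsE (card_uniqP ul) size_cat /=; lia.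
rewrite /bbit (negbTE nz) andbF => /eqP bx ->.
exists a, (x :: l); split=> //=.
- by rewrite xl.
- apply/setP=> y; rewrite inE in_cons; have /setP/(_ y) := sl; rewrite !inE => ->.
  by rewrite negb_and negbK.
- rewrite okl andbT.
  have -> : [set a; z] :|: [set x0 in l] = ~: S by rewrite -sl; apply/setP=> y;
    rewrite !inE mem_cat !inE orbC.
  by rewrite bx.
Qed.

End Orderings.

(** * Failure of the two greedy processes *)

Section Toggles.
Variable n : nat.
Implicit Types (E : {set {set 'I_n}}) (S A C D : {set 'I_n}) (v w z : 'I_n).

Definition sgraph (h : rel 'I_n) := mkg (fun v w => h v w (+) h w v).

Lemma adj_sgraph h v w : adj (sgraph h) v w = h v w (+) h w v.
Proof. by apply: adj_mkg => [x y|x]; rewrite ?addbb // addbC. Qed.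

Lemma dg_sgraph h v S : dg (sgraph h) v S =
  \big[addb/false]_(w in S) h v w (+) \big[addb/false]_(w in S) h w v.
Proof. by rewrite -big_split; apply: eq_bigr => w _; rewrite adj_sgraph. Qed.

Lemma big_addb_andl (S : {set 'I_n}) (c : bool) (b : pred 'I_n) :
  \big[addb/false]_(w in S) (c && b w) = c && \big[addb/false]_(w in S) b w.
Proof. by case: c => //=; rewrite big1. Qed.

Lemma big_addb_andr (S : {set 'I_n}) (c : bool) (b : pred 'I_n) :
  \big[addb/false]_(w in S) (b w && c) = (\big[addb/false]_(w in S) b w) && c.
Proof. by rewrite andbC -big_addb_andl; apply: eq_bigr => w _; rewrite andbC. Qed.

Lemma big_addb_mem A S : \big[addb/false]_(w in S) (w \in A) = odd #|A :&: S|.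
Proof. by rewrite big_addb_odd; congr (odd #|pred_of_set _|); apply/setP=> x; rewrite !inE andbC. Qed.

Lemma big_addb_eq z S : \big[addb/false]_(w in S) (w == z) = (z \in S).
Proof.
rewrite -[RHS]andbT -big_addb_pred1.
by apply: eq_bigr => w _; rewrite andbT.
Qed.

(* Adds modulo 2 the triangles x c z for x in A, where C = [set c] and c is the
   vertex removed last: inside any earlier state all degrees keep their parity,
   inside the current one exactly the degrees of A (and possibly z) change. At
   the initial state C is empty and only the edges x z are toggled. *)
Definition triangles z C A : rel 'I_n := fun v w =>
  ((v \in A) && ((w == z) (+) (w \in C))) (+) ((v \in C) && ((w == z) && odd #|A|)).

Lemma dg_triangles z C A v S : dg (sgraph (triangles z C A)) v S =
  ((v \in A) && ((z \in S) (+) odd #|C :&: S|)) (+) ((v \in C) && ((z \in S) && odd #|A|))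
  (+) ((odd #|A :&: S| && ((v == z) (+) (v \in C))) (+)
       (odd #|C :&: S| && ((v == z) && odd #|A|))).
Proof.
rewrite dg_sgraph /triangles !big_split /= !big_addb_andl !big_addb_andr !big_split /=.
by rewrite !big_addb_mem !big_addb_eq.
Qed.

Definition ftog z S' S A E := symd (sgraph (triangles z (S' :\: S) A)) E.

(* The vertex added last; at the initial state, where S' = S, this is z. *)
Definition bclast S' S := if S' == S then ~: S else S' :\: S.

Definition btog S' S A E :=
  symd (sgraph (fun v w => (v \in A) && (w \in bclast S' S))) E.

Lemma dg_complete A C v S : dg (sgraph (fun v w => (v \in A) && (w \in C))) v S =
  ((v \in A) && odd #|C :&: S|) (+) (odd #|A :&: S| && (v \in C)).
Proof. by rewrite dg_sgraph big_addb_andl big_addb_andr !big_addb_mem. Qed.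

Lemma sgraph_sub h : sgraph h \subset Kn n.
Proof. exact: mkg_sub. Qed.

Lemma symd_sgraph_graphs h E : E \in graphs n -> symd (sgraph h) E \in graphs n.
Proof. by rewrite !inE => sE; apply: symd_sub sE; apply: sgraph_sub. Qed.

Lemma card_forward_dead z D i : z \in D -> i <= #|~: D| ->
  #|[set E in graphs n | ~~ galive (@fbit n) D setT E i]| * 2 ^ (#|~: D| - i) <= #|graphs n|.
Proof.
move=> zD; rewrite -setTD => leiD.
have zt E k : z \in gtraj (@fbit n) D setT E k.
  by apply: (subsetP (gtraj_res _ _ _ (subsetT D))).
apply: (card_gdead (tog := ftog z)) leiD.
- by move=> S' S A E; rewrite /ftog symdK.
- by move=> S' S A E; apply: symd_sgraph_graphs.
- move=> E [//|j] A k _ al sA ltk v _; rewrite [_.+1.-1]/=.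
  have [c [_ cS _ trS]] := galiveS al.
  have sub := gtraj_sub (@fbit n) D setT E (ltk : k <= j).
  have eC : gtraj (@fbit n) D setT E j :\: gtraj (@fbit n) D setT E j.+1 = [set c].
    move: cS; rewrite inE => /andP[_ cS]; rewrite trS; apply/setP=> x; rewrite !inE.
    by have [->|_] := eqVneq x c; rewrite //= andbC; case: (x \in _).
  rewrite /fbit /ftog dg_symd eC dg_triangles.
  have -> : [set c] :&: gtraj (@fbit n) D setT E k = [set c].
    apply/setIidPl; rewrite sub1set; apply: (subsetP sub).
    by move: cS; rewrite inE => /andP[].
  have -> : A :&: gtraj (@fbit n) D setT E k = A.
    apply/setIidPl; apply: subset_trans sA _; apply: subset_trans (subsetDl _ _) _.
    by apply: gtraj_sub; apply: ltnW.
  rewrite cards1 zt /= andbF /=.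
  by case: (v == z); case: (v \in [set c]); case: (odd #|A|); rewrite ?addbF ?addbb.
- move=> E i0 A v _ al sA vS; set S' := gtraj _ _ _ _ i0.-1; set S := gtraj _ _ _ _ i0 in vS *.
  rewrite /fbit /ftog dg_symd dg_triangles.
  have -> : (S' :\: S) :&: S = set0 by rewrite setIDAC setDIl setDv setI0.
  have -> : A :&: S = A by apply/setIidPl; apply: subset_trans sA (subsetDl _ _).
  have vz : (v == z) = false.
    by apply: contraTF vS => /eqP ->; rewrite inE zD.
  have vC : (v \in S' :\: S) = false.
    by move: vS; rewrite !inE => /andP[_ ->].
  rewrite cards0 vz vC (zt E i0) /= andbF !addbF andbT.
  by case: (v \in A); case: dg.
Qed.

Lemma card_backward_dead tau z D i : z \notin D -> i <= #|~: (z |: D)| ->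
  #|[set E in graphs n | ~~ galive (bbit tau) D (~: [set z]) E i]| * 2 ^ (#|~: (z |: D)| - i)
  <= #|graphs n|.
Proof.
move=> zD; rewrite setCU -setDE => leiD.
apply: (card_gdead (tog := btog)) leiD.
- by move=> S' S A E; rewrite /btog symdK.
- by move=> S' S A E; apply: symd_sgraph_graphs.
- move=> E [//|j] A k _ al sA ltk v _; rewrite [_.+1.-1]/=.
  have [c [_ cS _ trS]] := galiveS al.
  have sub := gtraj_sub (bbit tau) D (~: [set z]) E (ltk : k <= j).
  rewrite /bbit /btog dg_symd dg_complete.
  set S' := gtraj _ _ _ _ j in cS trS sub *; set S := gtraj _ _ _ _ j.+1 in trS sA *.
  have -> : bclast S' S = S' :\: S.
    rewrite /bclast; case: eqP => // eS; have := cS; rewrite inE => /andP[_].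
    by rewrite {1}eS trS !inE eqxx.
  have -> : A :&: ~: gtraj (bbit tau) D (~: [set z]) E k = set0.
    apply/disjoint_setI0; rewrite -subsets_disjoint; apply: subset_trans sA _.
    by apply: subset_trans (subsetDl _ _) _; apply: gtraj_sub; apply: ltnW.
  have -> : (S' :\: S) :&: ~: gtraj (bbit tau) D (~: [set z]) E k = set0.
    apply/disjoint_setI0; rewrite -subsets_disjoint.
    by apply: subset_trans (subsetDl _ _) sub.
  by rewrite cards0 /= andbF.
- move=> E i0 A v _ al sA vS.
  rewrite /bbit /btog dg_symd dg_complete.
  have : (v \notin bclast (gtraj (bbit tau) D (~: [set z]) E i0.-1)
            (gtraj (bbit tau) D (~: [set z]) E i0)) /\
      #|bclast (gtraj (bbit tau) D (~: [set z]) E i0.-1)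
            (gtraj (bbit tau) D (~: [set z]) E i0) :&:
         ~: gtraj (bbit tau) D (~: [set z]) E i0| = 1.
    case: i0 al sA vS => [|j] al sA vS.
      rewrite /= /bclast eqxx setCK setIid cards1; split=> //.
      by move: vS; rewrite !inE => /andP[].
    have [c [_ cS _ trS]] := galiveS al.
    set S' := gtraj _ _ _ _ j.+1.-1; set S := gtraj _ _ _ _ j.+1 in vS trS *.
    have eS : S = S' :\ c by [].
    have cS' : c \in S' by move: cS; rewrite inE => /andP[].
    have nS : (S' == S) = false.
      by apply/eqP=> eS'; move: cS'; rewrite eS' eS !inE eqxx.
    rewrite /bclast nS; split.
      by move: vS; rewrite !inE => /andP[_ ->].
    rewrite (_ : _ :&: _ = [set c]) ?cards1 //; apply/setP=> x; rewrite eS !inE.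
    by have [->|_] := eqVneq x c; rewrite ?cS' //=; case: (x \in S').
  case=> /negbTE -> ->; rewrite andbF addbF andbT.
  by case: (v \in A); case: dg; case: eqP => //; case: andb.
Qed.

End Toggles.

(** * Assembling the order *)

Lemma card_few_images (G T : finType) (Om : {set G}) (Dr : {set {set T}})
    (alive : G -> pred {set T}) (f : G -> {set T} -> {set T}) (m : nat) :
  0 < m -> 2 ^ (8 * m) <= #|Dr| ->
  (forall E A, A \in Dr -> alive E A -> A \subset f E A /\ #|f E A| = 2 * m) ->
  (forall A, A \in Dr -> #|[set E in Om | ~~ alive E A]| * 2 ^ m <= #|Om|) ->
  #|[set E in Om | #|f E @: [set A in Dr | alive E A]| < 2 ^ (5 * m)]| * 2 ^ m
    <= 2 * #|Om|.
Proof.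
move=> m_gt0 leD fP aliveP; set B := [set E in Om | _].
pose dead E := [set A in Dr | ~~ alive E A].
have fib E : #|[set A in Dr | alive E A]| <= #|f E @: [set A in Dr | alive E A]| * 2 ^ (2 * m).
  rewrite -sum1_card (partition_big_imset (f E)) /= -sum_nat_const; apply: leq_sum => Q.
  case/imsetP=> A0; rewrite inE => /andP[A0D al0] eQ; rewrite sum1dep_card.
  have [_ <-] := fP E A0 A0D al0; rewrite -eQ -card_powerset; apply: subset_leq_card.
  apply/subsetP=> A; rewrite !inE => /andP[/andP[AD al] /eqP <-].
  by have [] := fP E A AD al.
have many E : E \in B -> #|Dr| <= 2 * #|dead E|.
  rewrite inE => /andP[_ few].
  have split : #|Dr| = #|[set A in Dr | alive E A]| + #|dead E|.
    rewrite -(cardsID [set A | alive E A] Dr); congr (_ + _); apply: eq_card => A.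
      by rewrite !inE.
    by rewrite !inE andbC.
  have lt7 : #|[set A in Dr | alive E A]| < 2 ^ (7 * m).
    apply: leq_ltn_trans (fib E) _.
    have -> : 7 * m = 5 * m + 2 * m by lia.
    by rewrite expnD ltn_pmul2r // expn_gt0.
  have : 2 * 2 ^ (7 * m) <= 2 ^ (8 * m) by rewrite -expnS leq_exp2l //; lia.
  lia.
have Dr_gt0 : 0 < #|Dr| by apply: leq_trans leD; rewrite expn_gt0.
have dc : \sum_(E in Om) #|dead E| = \sum_(A in Dr) #|[set E in Om | ~~ alive E A]|.
  transitivity (\sum_(E in Om) \sum_(A in Dr) (~~ alive E A : nat)).
    by apply: eq_bigr => E _; rewrite -sum1dep_card big_mkcondr; apply: eq_bigr => A _; case: (alive E A).
  rewrite exchange_big; apply: eq_bigr => A _.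
  by rewrite -sum1dep_card big_mkcondr; apply: eq_bigr => E _; case: (alive E A).
have le1 : #|B| * #|Dr| <= 2 * \sum_(E in Om) #|dead E|.
  rewrite -sum_nat_const big_distrr /= [leqRHS](big_setID B) /=.
  apply: leq_trans (leq_addr _ _); rewrite (setIidPr _); last by apply/subsetP=> E; rewrite inE => /andP[].
  exact: leq_sum.
have le2 : (\sum_(E in Om) #|dead E|) * 2 ^ m <= #|Dr| * #|Om|.
  by rewrite dc big_distrl -sum_nat_const; apply: leq_sum.
rewrite -(leq_pmul2l Dr_gt0); nia.
Qed.

Section Middle.
Variables (n m : nat) (W : {set 'I_n}) (z : 'I_n).
Hypothesis zW : z \in W.
Implicit Types (E : {set {set 'I_n}}) (S Q P : {set 'I_n}) (R : {set 'I_n * 'I_n}).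

(* The column z makes all row sums even, so that the twist below preserves the
   parity of the degree into W of every vertex outside W. *)
Definition rowfix R : rel 'I_n := fun v w =>
  [&& v \notin W, w \in W & if w == z then rsum R v (W :\ z) else (v, w) \in R].

Definition twist R E := symd (sgraph (rowfix R)) E.

Lemma twistK R : involutive (twist R).
Proof. by move=> E; rewrite /twist symdK. Qed.

Lemma twist_graphs R E : E \in graphs n -> twist R E \in graphs n.
Proof. exact: symd_sgraph_graphs. Qed.

Lemma rowfix_out R v S : v \in W -> \big[addb/false]_(w in S) rowfix R v w = false.
Proof. by move=> vW; apply: big1 => w _; rewrite /rowfix vW. Qed.

Lemma rowfix_in R v S : v \notin W -> \big[addb/false]_(w in S) rowfix R w v = false.
Proof. by move=> /negbTE vW; apply: big1 => w _; rewrite /rowfix vW andbF. Qed.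

Lemma dg_rowfix_disj R v S : v \notin W -> [disjoint S & W] ->
  dg (sgraph (rowfix R)) v S = false.
Proof.
move=> vW dS; rewrite dg_sgraph rowfix_in // addbF big1 // => w wS.
by rewrite /rowfix (disjointFr dS wS) andbF.
Qed.

Lemma dg_rowfix_row R v P : v \notin W -> P \subset W :\ z ->
  dg (sgraph (rowfix R)) v P = rsum R v P.
Proof.
move=> vW /subsetP sP; rewrite dg_sgraph rowfix_in // addbF.
apply: eq_bigr => w /sP; rewrite !inE => /andP[/negbTE wz wW].
by rewrite /rowfix vW wW wz.
Qed.

Lemma dg_rowfix_all R v : v \notin W -> dg (sgraph (rowfix R)) v W = false.
Proof.
move=> vW; rewrite -(setD1K zW) dgU; last by rewrite disjoints1 !inE eqxx.
by rewrite dg1 dg_rowfix_row // adj_sgraph /rowfix vW zW eqxx /= addbF addbb.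
Qed.

Lemma dg_rowfix_sup R v S : v \notin W -> W \subset S ->
  dg (sgraph (rowfix R)) v S = false.
Proof.
move=> vW sW; rewrite -(setID S W) (setIidPr sW) dgU; last by rewrite -setI_eq0 setIDA setDIl setDv set0I.
by rewrite dg_rowfix_all // dg_rowfix_disj // -setI_eq0 setIDAC setDIl setDv setI0.
Qed.

Lemma dg_rowfix_sub R v S : v \in W -> S \subset W ->
  dg (sgraph (rowfix R)) v S = false.
Proof.
move=> vW /subsetP sS; rewrite dg_sgraph rowfix_out // big1 // => w /sS wW.
by rewrite /rowfix wW.
Qed.

Lemma dg_rowfix_col R v Q : v \in W :\ z -> [disjoint Q & W] ->
  dg (sgraph (rowfix R)) v Q = csum R v Q.
Proof.
rewrite !inE => /andP[/negbTE vz vW] dQ; rewrite dg_sgraph rowfix_out //.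
by apply: eq_bigr => w wQ; rewrite /rowfix (disjointFr dQ wQ) vW vz.
Qed.

Definition nfwd := #|~: W| - 2 * m.
Definition nbwd := #|W :\ z| - 2 * m.

Definition fdraws := [set A : {set 'I_n} | A \subset ~: W & #|A| == m].
Definition bdraws := [set A : {set 'I_n} | A \subset W :\ z & #|A| == m].

Definition falive E A := galive (@fbit n) (W :|: A) setT E nfwd.
Definition balive tau E A := galive (bbit tau) (~: W :|: A) (~: [set z]) E nbwd.

Definition fleft E A := gtraj (@fbit n) (W :|: A) setT E nfwd :\: W.
Definition bleft tau E A := gtraj (bbit tau) (~: W :|: A) (~: [set z]) E nbwd :&: W.

Definition ffam E := fleft E @: [set A in fdraws | falive E A].
Definition bfam tau E := bleft tau E @: [set A in bdraws | balive tau E A].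

Hypothesis large1 : 2 * m < #|~: W|.
Hypothesis large2 : 2 * m < #|W :\ z|.

Lemma fdrawsP A : A \in fdraws -> [/\ A \subset ~: W, #|~: (W :|: A)| = #|~: W| - m &
  #|~: (W :|: A)| - nfwd = m].
Proof using large1.
clear zW large2.
rewrite inE => /andP[sA /eqP cA]; have e : #|~: (W :|: A)| = #|~: W| - m.
  by rewrite setCU -setDE cardsD (setIidPr sA) cA.
by split=> //; rewrite e /nfwd; lia.
Qed.

Lemma bdrawsP A : A \in bdraws -> [/\ A \subset W :\ z, z \notin ~: W :|: A,
   #|~: (z |: (~: W :|: A))| = #|W :\ z| - m &
  #|~: (z |: (~: W :|: A))| - nbwd = m].
Proof using zW large2.
clear large1.
rewrite inE => /andP[sA /eqP cA]; have e : #|~: (z |: (~: W :|: A))| = #|W :\ z| - m.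
  have -> : ~: (z |: (~: W :|: A)) = (W :\ z) :\: A.
    by apply/setP=> x; rewrite !inE !negb_or negbK; do !case: (_ \in _); rewrite ?andbF ?andbT.
  by rewrite (cardsD (W :\ z) A) (setIidPr sA) cA.
split=> //; last by rewrite e /nbwd; lia.
by rewrite !inE zW; apply: contraTN isT => /(subsetP sA); rewrite !inE eqxx.
Qed.

Lemma fleftP E A : A \in fdraws -> falive E A ->
  A \subset fleft E A /\ #|fleft E A| = 2 * m.
Proof using large1.
clear zW large2.
move=> AD al; have [sA cA _] := fdrawsP AD.
have res : W :|: A \subset gtraj (@fbit n) (W :|: A) setT E nfwd by apply: gtraj_res; apply: subsetT.
have sub : A \subset fleft E A.
  rewrite /fleft subsetD (subset_trans (subsetUr _ _) res) /=.
  by rewrite disjoints_subset.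
split=> //; have := galive_card al; rewrite setTD cA.
have -> : gtraj (@fbit n) (W :|: A) setT E nfwd :\: (W :|: A) = fleft E A :\: A by rewrite setDDl.
rewrite cardsD (setIidPr sub); have := subset_leq_card sub.
by move: AD; rewrite inE => /andP[_ /eqP ->]; rewrite /nfwd; lia.
Qed.

Lemma bleftP tau E A : A \in bdraws -> balive tau E A ->
  A \subset bleft tau E A /\ #|bleft tau E A| = 2 * m.
Proof using zW large2.
clear large1.
move=> AD al; have [sA zA cA _] := bdrawsP AD.
have res : ~: W :|: A \subset gtraj (bbit tau) (~: W :|: A) (~: [set z]) E nbwd.
  by apply: gtraj_res; rewrite subsetC sub1set inE.
have sub : A \subset bleft tau E A.
  rewrite /bleft subsetI (subset_trans (subsetUr _ _) res) /=.
  by apply: subset_trans sA (subsetDl _ _).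
split=> //; have := galive_card al.
have -> : ~: [set z] :\: (~: W :|: A) = ~: (z |: (~: W :|: A)) by rewrite setDE -setCU.
rewrite cA.
have -> : gtraj (bbit tau) (~: W :|: A) (~: [set z]) E nbwd :\: (~: W :|: A) = bleft tau E A :\: A.
  by rewrite -setDDl [_ :\: ~: W]setDE setCK.
rewrite cardsD (setIidPr sub); have := subset_leq_card sub.
by move: AD; rewrite inE => /andP[_ /eqP ->]; rewrite /nbwd; lia.
Qed.

Lemma ffam_forward E Q : E \subset Kn n -> Q \in ffam E -> exists l,
  [/\ Q \subset ~: W, #|Q| = 2 * m, uniq l, [set x in l] = ~: (Q :|: W) & removable E (Q :|: W) l].
Proof using large1.
move=> sE /imsetP[A]; rewrite inE => /andP[AD al] ->.
have [_ cQ] := fleftP AD al.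
have [l [ul sl okl]] := greedy_forward_list sE al.
have res : W :|: A \subset gtraj (@fbit n) (W :|: A) setT E nfwd by apply: gtraj_res; apply: subsetT.
have eT : fleft E A :|: W = gtraj (@fbit n) (W :|: A) setT E nfwd.
  apply/setP=> x; rewrite /fleft !inE.
  case: (boolP (x \in W)) => xW; rewrite ?andbF ?andbT ?orbF //=.
  by rewrite (subsetP res) // inE xW.
exists l; rewrite eT; split=> //; last by rewrite sl setTD.
by apply/subsetP=> x; rewrite !inE => /andP[].
Qed.

Lemma bfam_backward tau E P : E \subset Kn n -> P \in bfam tau E -> exists a l,
  [/\ P \subset W :\ z /\ #|P| = 2 * m, uniq (l ++ [:: a; z]),
      [set x in l ++ [:: a; z]] = W :\: P, removable E [set a; z] l & adj E a z = tau].
Proof using zW large2.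
clear large1.
move=> sE /imsetP[A]; rewrite inE => /andP[AD al] ->.
have [_ cP] := bleftP AD al; have [sA zA _ _] := bdrawsP AD.
have nb : nbwd = nbwd.-1.+1 by rewrite /nbwd; lia.
have al' := al; rewrite /balive nb in al'.
have [a [l [ul sl okl az]]] := greedy_backward_list sE al'; rewrite -nb in sl.
have res : ~: W :|: A \subset gtraj (bbit tau) (~: W :|: A) (~: [set z]) E nbwd.
  by apply: gtraj_res; rewrite subsetC sub1set inE.
exists a, l; split=> //.
  split=> //; apply/subsetP=> x; rewrite !inE => /andP[xS ->]; rewrite andbT.
  have := subsetP (gtraj_sub (bbit tau) (~: W :|: A) (~: [set z]) E (leq0n nbwd)) _ xS.
  by rewrite !inE.
rewrite sl; apply/setP=> x; rewrite !inE.
case: (boolP (x \in W)) => xW; rewrite ?andbF ?andbT //=.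
by rewrite (subsetP res) // !inE xW.
Qed.

Lemma ffam_twist R E : ffam (twist R E) = ffam E.
Proof using zW.
have key A : gtraj (@fbit n) (W :|: A) setT (twist R E) nfwd = gtraj (@fbit n) (W :|: A) setT E nfwd
    /\ falive (twist R E) A = falive E A.
  apply: gtraj_congr => k _ v; rewrite !inE negb_or => /andP[/andP[vW _] _].
  rewrite /fbit dg_symd dg_rowfix_sup //.
  by apply: subset_trans (subsetUl W A) _; apply: gtraj_res; apply: subsetT.
rewrite /ffam (_ : [set A in fdraws | falive (twist R E) A] = [set A in fdraws | falive E A]).
  by apply: eq_imset => A; rewrite /fleft (key A).1.
by apply/setP=> A; rewrite !inE (key A).2.
Qed.

Lemma bfam_twist tau R E : bfam tau (twist R E) = bfam tau E.
Proof using zW large2.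
have key A : A \in bdraws ->
    gtraj (bbit tau) (~: W :|: A) (~: [set z]) (twist R E) nbwd =
    gtraj (bbit tau) (~: W :|: A) (~: [set z]) E nbwd
    /\ balive tau (twist R E) A = balive tau E A.
  move=> AD; have [_ zA _ _] := bdrawsP AD.
  apply: gtraj_congr => k _ v; rewrite !inE negb_or negbK => /andP[/andP[vW _] _].
  rewrite /bbit dg_symd dg_rowfix_sub //.
  rewrite subCset; apply: subset_trans (subsetUl _ A) _; apply: gtraj_res.
  by rewrite subsetC sub1set inE.
rewrite /bfam (_ : [set A in bdraws | balive tau (twist R E) A] = [set A in bdraws | balive tau E A]).
  by apply: eq_in_imset => A; rewrite inE => /andP[AD _]; rewrite /bleft (key A AD).1.
apply/setP=> A; rewrite [in LHS]inE [in RHS]inE.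
by case: (boolP (A \in bdraws)) => //= AD; rewrite (key A AD).2.
Qed.

Definition rowtarget E Q P x := dg E x ((W :\: P) :|: later (enum Q) x).
Definition coltarget E Q P y := dg E y ((Q :|: (W :\: P)) :|: later (enum P) y).

Lemma set_enum S : [set x in enum S] = S.
Proof. by apply/setP=> x; rewrite inE mem_enum. Qed.

Lemma targets_consistent E Q P : E \subset Kn n ->
  Q \in ffam E -> P \in bfam (par E setT) E ->
  \big[addb/false]_(x in Q) rowtarget E Q P x = \big[addb/false]_(y in P) coltarget E Q P y.
Proof using zW large1 large2.
move=> sE /(ffam_forward sE)[lX [sQ cQ uX sX okX]] /(bfam_backward sE)[a [l [[sP cP] ul sl okl az]]].
have dQY : [disjoint W :\: P & Q].
  rewrite disjoint_sym disjoints_subset; apply: subset_trans sQ _.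
  by rewrite setCS subsetDl.
have dQYP : [disjoint Q :|: (W :\: P) & P].
  rewrite disjoints_subset subUset setDE subsetIr andbT.
  by apply: subset_trans sQ _; rewrite setCS (subset_trans sP) // subsetDl.
have sum_enum (S : {set 'I_n}) (f : 'I_n -> bool) :
    \big[addb/false]_(x in S) f x = \big[addb/false]_(x <- enum S) f x by rewrite big_enum.
rewrite !sum_enum /rowtarget /coltarget.
rewrite sum_dg_later ?enum_uniq ?set_enum // sum_dg_later ?enum_uniq ?set_enum //.
have -> : Q :|: (W :\: P) :|: P = Q :|: W.
  rewrite -setUA; congr (_ :|: _); apply/setP=> x; rewrite !inE orb_andl orNb /=.
  by apply: orb_idr => /(subsetP sP); rewrite !inE => /andP[].
have <- : par E setT = par E (Q :|: W).
  rewrite -(@par_removable _ E (Q :|: W) lX) // sX ?setUCr //.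
  by rewrite -setI_eq0 setICr.
move: (ul); rewrite cat_uniq => /and3P[ull /hasPn dl]; rewrite /= inE andbT => naz.
have {}dl : [disjoint [set a; z] & [set x in l]].
  by rewrite disjoints_subset subUset !sub1set !inE !dl ?mem_head // inE mem_head orbT.
have -> : par E (W :\: P) = par E setT.
  have -> : W :\: P = [set a; z] :|: [set x in l].
    by rewrite -sl; apply/setP=> x; rewrite !inE mem_cat !inE orbC.
  rewrite par_removable // par_setU1 ?inE // par1 // dg1 az //.
by rewrite [[set: _] in RHS]/= [W :\: P :|: Q]setUC addbC.
Qed.

Lemma solved_even_degenerate E Q P R : E \subset Kn n ->
  Q \in ffam E -> P \in bfam (par E setT) E ->
  solved (rowtarget E) (coltarget E) R Q P -> even_degenerate (twist R E).
Proof using zW large1 large2.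
move=> sE QF PF /andP[/forall_inP okQ /forall_inP okP].
have sE' : twist R E \subset Kn n by have := @twist_graphs R E; rewrite !inE; apply.
rewrite -(ffam_twist R) in QF; rewrite -(bfam_twist _ R) in PF.
have [lX [sQ cQ uX sX okX]] := ffam_forward sE' QF.
have [a [l [[sP cP] ul sl okl az]]] := bfam_backward sE' PF.
have dQW : [disjoint Q & W] by rewrite disjoints_subset.
have sPW : P \subset W by apply: subset_trans sP (subsetDl _ _).
have sY : [set a; z] :|: [set x in l] = W :\: P.
  by rewrite -sl; apply/setP=> x; rewrite !inE mem_cat !inE orbC.
pose L := lX ++ (enum P ++ (enum Q ++ l)).
have memY x : (x \in l ++ [:: a; z]) = (x \in W) && (x \notin P).
  by have /setP/(_ x) := sl; rewrite !inE andbC.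
have memX x : (x \in lX) = (x \notin Q) && (x \notin W).
  by have /setP/(_ x) := sX; rewrite !inE negb_or.
have QW x : x \in Q -> x \notin W by move=> xQ; rewrite (disjointFr dQW xQ).
have PW x : x \in P -> x \in W by apply: (subsetP sPW).
have ucat (s t : seq 'I_n) : uniq s -> uniq t -> (forall x, x \in t -> x \notin s) -> uniq (s ++ t).
  by move=> us ut dst; rewrite cat_uniq us ut andbT; apply/hasPn.
have laterP x : later (enum P) x \subset P by have := later_sub (enum P) x; rewrite set_enum.
have laterQ x : later (enum Q) x \subset Q by have := later_sub (enum Q) x; rewrite set_enum.
apply: (@removable_even_degenerate _ _ a z L).
- rewrite /L -!catA; apply: (ucat) => //; first apply: (ucat); rewrite ?enum_uniq //.
  + apply: (ucat); rewrite ?enum_uniq // => x; rewrite memY mem_enum => /andP[xW _].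
    by apply: contraL xW => /QW.
  + move=> x; rewrite mem_cat !mem_enum memY => /orP[/QW|/andP[]//].
    by apply: contra => /PW.
  + move=> x; rewrite !mem_cat -mem_cat !mem_enum memY memX.
    by case: (boolP (x \in W)) => xW; rewrite ?andbF //= andbT orbF negbK => /orP[/PW|//];
      rewrite (negbTE xW).
- apply/setP=> x; rewrite !inE /L -!catA !mem_cat -mem_cat !mem_enum memY memX.
  by case: (boolP (x \in W)) => xW; case: (boolP (x \in Q)); case: (boolP (x \in P)).
rewrite /L removable_cat; apply/andP; split.
  rewrite (_ : _ :|: _ = Q :|: W) //; apply/setP=> x; have := memY x.
  rewrite !inE !mem_cat !mem_enum !inE.
  case: (boolP (x \in P)) => xP /=; first by rewrite PW // !orbT.
  rewrite andbT => <-; case: (x \in Q); case: (x \in l); case: (x == a); case: (x == z) => //.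
rewrite removable_cat set_cat set_enum setUCA sY; apply/andP; split.
  rewrite removableE ?enum_uniq //; apply/allP=> y; rewrite mem_enum => yP.
  rewrite dg_symd -/(coltarget E Q P y) -(eqP (okP y yP)).
  have sYl : W :\: P :|: later (enum P) y \subset W.
    by rewrite subUset subsetDl (subset_trans (laterP y)).
  rewrite -setUA dgU; last first.
    by rewrite disjoint_sym (disjointWl sYl) // disjoint_sym.
  by rewrite dg_rowfix_col ?(subsetP sP) // dg_rowfix_sub ?PW // addbF addbb.
rewrite removable_cat okl andbT sY removableE ?enum_uniq //; apply/allP=> x; rewrite mem_enum => xQ.
rewrite dg_symd -/(rowtarget E Q P x) -(eqP (okQ x xQ)).
rewrite dgU; last first.
  rewrite (disjointWl (subsetDl _ _)) // disjoint_sym.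
  by rewrite (disjointWl (laterQ x)).
rewrite [dg _ _ (later _ _)]dg_rowfix_disj ?QW //; last by rewrite (disjointWl (laterQ x)).
have := dg_rowfix_all R (QW x xQ).
rewrite -[X in dg _ _ X](setID W P) (setIidPr sPW) dgU; last first.
  by rewrite -setI_eq0 setIDA setDIl setDv set0I.
by rewrite dg_rowfix_row ?QW // => e; rewrite addbF addbC e.
Qed.

End Middle.

(** * Lower bound *)

Section LowerBound.
Variables (n : nat) (a b : 'I_n).
Hypotheses (n_ge4 : 3 < n) (nab : a != b).
Implicit Types (E : {set {set 'I_n}}) (v w : 'I_n).

Let core := ~: [set a; b].

Let in_core v : (v \in core) = (v != a) && (v != b).
Proof. by rewrite !inE negb_or. Qed.

(* The neighbours of [a] among the other vertices make all of [core] odd. *)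
Definition hub E := [set v in core | ~~ dg E v core].

Definition oddrel E : rel 'I_n := fun v w =>
  [|| [&& v \in core, w \in core & adj E v w],
      (v == a) && (w \in hub E), (w == a) && (v \in hub E) |
      ~~ odd #|hub E| && (((v == a) && (w == b)) || ((v == b) && (w == a)))].

Lemma oddrel_sym E : symmetric (oddrel E).
Proof.
move=> v w; rewrite /oddrel adjC andbCA; congr (_ || _); rewrite orbCA; congr [|| _, _ | _ && _].
by rewrite orbC [X in X || _]andbC [X in _ || X]andbC.
Qed.

Lemma oddrel_irr E : E \subset Kn n -> irreflexive (oddrel E).
Proof.
move=> sE v; rewrite /oddrel adjnn // !andbF /= !inE.
have [->|_] := eqVneq v a; rewrite ?eqxx /= ?(negbTE nab) ?andbF //.
Qed.

Definition oddgraph E := mkg (oddrel E).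

Lemma adj_oddgraph E v w : E \subset Kn n -> adj (oddgraph E) v w = oddrel E v w.
Proof. by move=> sE; rewrite adj_mkg //; [apply: oddrel_sym | apply: oddrel_irr]. Qed.

Lemma dg_oddgraph_core E v : E \subset Kn n -> v \in core ->
  dg (oddgraph E) v (~: [set b]) = true.
Proof.
move=> sE vc; have -> : ~: [set b] = a |: core.
  by apply/setP=> x; rewrite !inE; have [->|_] := eqVneq x a; rewrite ?nab.
rewrite dgU; last by rewrite disjoints1 in_core eqxx.
rewrite dg1 adj_oddgraph //.
have := vc; rewrite in_core => /andP[/negbTE va /negbTE vb].
have -> : dg (oddgraph E) v core = dg E v core.
  apply: eq_bigr => w wc; rewrite adj_oddgraph // /oddrel vc wc va.
  by move: wc; rewrite in_core => /andP[/negbTE -> /negbTE ->]; rewrite /= !andbF !orbF.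
rewrite /oddrel va vb eqxx (in_core a) eqxx /= !andbF /= orbF inE vc.
by case: dg.
Qed.

Lemma oddgraph_b E v : E \subset Kn n ->
  adj (oddgraph E) v b = (v == a) && ~~ odd #|hub E|.
Proof.
move=> sE; rewrite adj_oddgraph // /oddrel !in_core !inE eqxx [b == a]eq_sym (negbTE nab) /=.
by rewrite !andbF /= !orbF andbT andbC.
Qed.

Lemma dg_oddgraph_a E : E \subset Kn n -> dg (oddgraph E) a setT = true.
Proof.
move=> sE; have -> : setT = b |: (a |: core).
  by apply/setP=> x; rewrite !inE; case: (x == a); case: (x == b).
have nb : b \notin a |: core by rewrite !inE eqxx orbT orbF eq_sym nab.
rewrite dgU ?disjoints1 // dg1 oddgraph_b // eqxx dgU ?disjoints1 ?in_core ?eqxx // dg1.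
rewrite adjnn ?mkg_sub //.
have -> : dg (oddgraph E) a core = odd #|hub E|.
  rewrite -(@big_addb_sub _ (hub E) core); last by apply/subsetP=> x; rewrite inE => /andP[].
  apply: eq_bigr => w; rewrite in_core => /andP[/negbTE wa /negbTE wb].
  by rewrite adj_oddgraph // /oddrel in_core eqxx wa wb (negbTE nab) /= !andbF !orbF.
by case: odd.
Qed.

Lemma oddgraph_stuck E : E \subset Kn n -> ~~ even_degenerate (oddgraph E).
Proof.
move=> sE; apply/negP=> /existsP[s /forallP ok].
have dgs (i : 'I_n) (S : {set 'I_n}) : i < n - 2 ->
    [set s j | j in [set j : 'I_n | i < j]] = S -> dg (oddgraph E) (s i) S = false.
  move=> lti <-; have := ok i; rewrite lti /= => /negbTE <-; rewrite /dg big_addb_odd.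
  rewrite -[in RHS](card_imset _ (@perm_inj _ s)); congr (odd #|pred_of_set _|).
  apply/setP=> x; apply/idP/imsetP=> [|[j]].
    by rewrite inE => /andP[/imsetP[j ij ->] aE]; exists j; rewrite // inE [_ \in oddgraph E]aE andbT; move: ij; rewrite inE.
  by rewrite [j \in _]inE => /andP[ij aE] ->; rewrite inE [adj _ _ _]aE andbT imset_f // inE.
have sub (S : {set 'I_n}) : forall (i : 'I_n), (forall j : 'I_n, (i < j) = (s j \in S)) ->
    [set s j | j in [set j : 'I_n | i < j]] = S.
  move=> i iS; apply/setP=> x; apply/imsetP/idP=> [[j]|xS].
    by rewrite inE iS => ? ->.
  by exists (s^-1%g x); rewrite ?permKV // inE iS permKV.
have lt0 : 0 < n by lia.
have lt1 : 1 < n by lia.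
pose i0 := Ordinal lt0; pose i1 := Ordinal lt1.
have e0 : dg (oddgraph E) (s i0) setT = false.
  rewrite -(dgD1 _ _ (mkg_sub _)); apply: dgs; first by rewrite /=; lia.
  apply: sub => j; rewrite !inE andbT (inj_eq perm_inj) -val_eqE /=; lia.
have s0b : s i0 = b.
  apply/eqP; apply: contraFT e0 => s0b.
  have [->|s0a] := eqVneq (s i0) a; first by rewrite dg_oddgraph_a.
  have -> : setT = b |: ~: [set b] by rewrite setUCr.
  rewrite dgU ?disjoints1 ?inE ?eqxx // dg1 oddgraph_b // (negbTE s0a) /=.
  by rewrite dg_oddgraph_core // in_core s0a.
have hub_odd : odd #|hub E|.
  move: e0; rewrite s0b.
  have -> : dg (oddgraph E) b setT = ~~ odd #|hub E|; last by move/negbFE.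
  rewrite /dg (bigD1 a) ?inE // adjC oddgraph_b // eqxx big1; first by case: odd.
  by move=> w /andP[_ /negbTE wa]; rewrite adjC oddgraph_b // wa.
have e1 : dg (oddgraph E) (s i1) (~: [set b]) = false.
  rewrite -(dgD1 _ _ (mkg_sub _)); apply: dgs; first by rewrite /=; lia.
  apply: sub => j; rewrite !inE -s0b !(inj_eq perm_inj) -!val_eqE /=; lia.
have s1b : s i1 != b by rewrite -s0b (inj_eq perm_inj).
case/negP: (negbT e1); have [s1a|s1a] := eqVneq (s i1) a; last first.
  by rewrite dg_oddgraph_core // in_core s1a.
have := dg_oddgraph_a sE; rewrite s1a -(setUCr [set b]).
by rewrite dgU ?disjoints1 ?inE ?eqxx // dg1 oddgraph_b // hub_odd andbF.
Qed.

Lemma card_not_even_degenerate_ge :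
  #|graphs n| <= #|[set E in graphs n | ~~ even_degenerate E]| * (2 ^ n * 2 ^ n).
Proof.
pose nb E v := [set w | adj E v w].
pose f E := (oddgraph E, (nb E a, nb E b)).
have injf : {in graphs n &, injective f}.
  move=> E F; rewrite !inE => sE sF [eo ea eb].
  have adjEF v w : adj E v w = adj F v w.
    have av x : adj E a x = adj F a x by have /setP/(_ x) := ea; rewrite !inE.
    have bv x : adj E b x = adj F b x by have /setP/(_ x) := eb; rewrite !inE.
    have [->//|va] := eqVneq v a; have [->//|vb] := eqVneq v b.
    have [->|wa] := eqVneq w a; first by rewrite adjC av adjC.
    have [->|wb] := eqVneq w b; first by rewrite adjC bv adjC.
    have: adj (oddgraph E) v w = adj (oddgraph F) v w by rewrite eo.
    rewrite !adj_oddgraph // /oddrel !in_core va vb wa wb.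
    by rewrite (negbTE va) (negbTE wa) /= !andbF !orbF.
  apply/setP=> e; apply/idP/idP=> eE.
    have := subsetP sE e eE; rewrite inE => /cards2P[v [w [_ ee]]].
    by have := adjEF v w; rewrite /adj -ee eE.
  have := subsetP sF e eE; rewrite inE => /cards2P[v [w [_ ee]]].
  by have := adjEF v w; rewrite /adj -ee eE.
rewrite -(card_in_imset injf).
have sub : f @: graphs n \subset
    setX [set E in graphs n | ~~ even_degenerate E] (setX (powerset setT) (powerset setT)).
  apply/subsetP=> p /imsetP[E EG ->]; have sE : E \subset Kn n by move: EG; rewrite inE.
  by rewrite !inE !subsetT oddgraph_stuck // mkg_sub.
by apply: leq_trans (subset_leq_card sub) _; rewrite !cardsX card_powerset cardsT card_ord.
Qed.

End LowerBound.

(** * Upper bound *)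

Lemma leq_exp_bin a w m : 0 < a -> a * m <= w -> a ^ m <= 'C(w, m).
Proof.
move=> a_gt0; elim: m w => [|m IHm] w le_w; first by rewrite bin0.
have le_w' : a * m <= w.-1 by nia.
rewrite -(leq_pmul2l (ltn0Sn m)) -mul_bin_diag expnS mulnA [m.+1 * a]mulnC.
exact: leq_mul le_w (IHm _ le_w').
Qed.

Section UpperBound.
Variables (n m : nat) (W : {set 'I_n}) (z : 'I_n).
Hypotheses (zW : z \in W) (m_gt0 : 0 < m).
Hypotheses (large1 : 256 * m <= #|~: W|) (large2 : 256 * m <= #|W :\ z|).
Implicit Types (E : {set {set 'I_n}}).

Let lt1 : 2 * m < #|~: W|. Proof. by move: large1; lia. Qed.
Let lt2 : 2 * m < #|W :\ z|. Proof. by move: large2; lia. Qed.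

Lemma card_few_ffam :
  #|[set E in graphs n | #|ffam m W E| < 2 ^ (5 * m)]| * 2 ^ m <= 2 * #|graphs n|.
Proof.
apply: card_few_images => //.
- by rewrite cards_draws expnM; apply: leq_exp_bin.
- by move=> E A; apply: fleftP.
move=> A AD; have [sA cA eA] := fdrawsP lt1 AD.
rewrite -[X in 2 ^ X]eA; apply: (card_forward_dead (z := z)); first by rewrite inE zW.
by rewrite cA /nfwd; lia.
Qed.

Lemma card_few_bfam tau :
  #|[set E in graphs n | #|bfam m W z tau E| < 2 ^ (5 * m)]| * 2 ^ m <= 2 * #|graphs n|.
Proof.
apply: card_few_images => //.
- by rewrite cards_draws expnM; apply: leq_exp_bin.
- by move=> E A; apply: bleftP.
move=> A AD; have [sA zA cA eA] := bdrawsP zW lt2 AD.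
rewrite -[X in 2 ^ X]eA; apply: card_backward_dead => //.
by rewrite cA /nbwd; lia.
Qed.

Lemma card_twist_not_even_degenerate E : E \in graphs n ->
  2 ^ (5 * m) <= #|ffam m W E| -> 2 ^ (5 * m) <= #|bfam m W z (par E setT) E| ->
  #|[set R | ~~ even_degenerate (twist W z R E)]| * 2 ^ m <= #|{set 'I_n * 'I_n}|.
Proof.
rewrite inE => sE; set F := ffam m W E; set B := bfam m W z _ E => leF leB.
have FP Q : Q \in F -> #|Q| = 2 * m by case/(ffam_forward lt1 sE) => ? [].
have BP P : P \in B -> #|P| = 2 * m by case/(bfam_backward zW lt2 sE) => ? [? [[]]].
have cons Q P : Q \in F -> P \in B ->
    \big[addb/false]_(x in Q) rowtarget W E Q P x
    = \big[addb/false]_(y in P) coltarget W E Q P y.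
  exact: (targets_consistent zW lt1 lt2).
have s_gt0 : 0 < 2 * m by lia.
have := card_unsolved s_gt0 FP BP cons.
set U := [set R | _]; set N := [set R | _]; set tot := #|{set 'I_n * 'I_n}| => leU.
have leN : #|N| <= #|U|.
  apply: subset_leq_card; apply/subsetP=> R; rewrite !inE; apply: contra.
  case/exists_inP=> Q QF /exists_inP[P PB] sol.
  exact: (solved_even_degenerate zW lt1 lt2 sE QF PB).
have e4 : 2 * 2 ^ (2 * (2 * m)).-1 = 2 ^ (4 * m).
  by rewrite -expnS; congr (2 ^ _); lia.
have e5 : 2 ^ (5 * m) = 2 ^ (4 * m) * 2 ^ m by rewrite -expnD; congr (2 ^ _); lia.
have p4 : 0 < 2 ^ (4 * m) by rewrite expn_gt0.
set k := 2 ^ (2 * (2 * m)).-1 in leU e4; set K4 := 2 ^ (4 * m) in e4 e5 p4.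
set b := 2 ^ (5 * m) in leF leB e5.
have FB_gt0 : 0 < #|F| * #|B|.
  by rewrite muln_gt0 !(leq_trans _ leF) ?(leq_trans _ leB) // expn_gt0.
have h1 : (#|F| + #|B|) * b <= 2 * (#|F| * #|B|) by nia.
have h2 : #|U| * b * (#|F| * #|B|) <= K4 * tot * (#|F| * #|B|).
  rewrite mulnAC; apply: (@leq_trans (k * (#|F| + #|B|) * tot * b)).
    by rewrite leq_mul2r leU orbT.
  rewrite (_ : _ * b = k * tot * ((#|F| + #|B|) * b)); last by lia.
  by apply: leq_trans (leq_mul (leqnn _) h1) _; rewrite -e4; lia.
rewrite leq_pmul2r // e5 mulnA [_ * K4]mulnC -mulnA leq_pmul2l // in h2.
by apply: leq_trans h2; rewrite leq_mul2r leN orbT.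
Qed.

Lemma card_not_even_degenerate_le :
  #|[set E in graphs n | ~~ even_degenerate E]| * 2 ^ m <= 7 * #|graphs n|.
Proof.
set ND := [set E in graphs n | _]; pose tot := #|{set 'I_n * 'I_n}|.
pose bad0 := [set E in graphs n | #|ffam m W E| < 2 ^ (5 * m)].
pose bad1 tau := [set E in graphs n | #|bfam m W z tau E| < 2 ^ (5 * m)].
pose bad := bad0 :|: (bad1 true :|: bad1 false).
have card_bad : #|bad| * 2 ^ m <= 6 * #|graphs n|.
  have := card_few_ffam; have := card_few_bfam true; have := card_few_bfam false.
  rewrite -/bad0 -/(bad1 true) -/(bad1 false).
  have : #|bad| <= #|bad0| + (#|bad1 true| + #|bad1 false|).
    apply: leq_trans (leq_card_setU _ _) _; rewrite leq_add2l.
    exact: leq_card_setU.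
  by nia.
pose N E := #|[set R | ~~ even_degenerate (twist W z R E)]|.
have dc : #|ND| * tot = \sum_(E in graphs n) N E.
  transitivity (\sum_(R : {set 'I_n * 'I_n}) #|ND|); first by rewrite sum_nat_const mulnC.
  transitivity (\sum_(R : {set 'I_n * 'I_n}) \sum_(E in graphs n)
      (~~ even_degenerate (twist W z R E) : nat)); last first.
    by rewrite exchange_big; apply: eq_bigr => E _; rewrite card_as_sum.
  apply: eq_bigr => R _; rewrite -(card_imset _ (can_inj (twistK W z R))).
  rewrite -sum1_card (eq_bigl (fun E => (E \in graphs n) && ~~ even_degenerate (twist W z R E))).
    by rewrite big_mkcondr; apply: eq_bigr => E _; case: even_degenerate.
  move=> E; apply/imsetP/andP=> [[F]|[EG nE]].
    by rewrite inE => /andP[FG nF] ->; rewrite twistK; split; first exact: twist_graphs.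
  by exists (twist W z R E); rewrite ?twistK // inE nE andbT; apply: twist_graphs.
have boundN E : E \in graphs n -> N E * 2 ^ m <= (E \in bad) * (tot * 2 ^ m) + tot.
  move=> EG; case: (boolP (E \in bad)) => Eb.
    by rewrite mul1n; apply: leq_trans (leq_addr _ _); rewrite leq_mul2r max_card orbT.
  rewrite mul0n add0n; move: Eb; rewrite !inE in EG *; rewrite EG /= !negb_or -!leqNgt.
  case/and3P=> b0 b1 b2; apply: card_twist_not_even_degenerate => //; first by rewrite inE.
  by case: par.
have tot_gt0 : 0 < tot by apply/card_gt0P; exists set0.
rewrite -(leq_pmul2l tot_gt0) mulnA [tot * _]mulnC dc big_distrl /=.
apply: (leq_trans (leq_sum _ boundN)); rewrite big_split /= sum_nat_const -big_distrl /=.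
have -> : \sum_(E in graphs n) (E \in bad) = #|bad|.
  rewrite -sum1_card big_mkcond [RHS]big_mkcond; apply: eq_bigr => E _.
  case: (boolP (E \in bad)) => [Eb|_]; last by case: ifP.
  by have -> : E \in graphs n by move: Eb; rewrite !inE -!andb_orr => /andP[].
rewrite mulnCA [#|graphs n| * tot]mulnC -mulnDr leq_mul2l; apply/orP; right; apply: leq_trans (leq_add card_bad (leqnn _)) _; by rewrite -mulSnr.
Qed.

End UpperBound.

Lemma exists_split n m : 1024 * m <= n -> 0 < m -> exists (W : {set 'I_n}) (z : 'I_n),
  [/\ z \in W, 256 * m <= #|~: W| & 256 * m <= #|W :\ z|].
Proof.
move=> le_n m_gt0; have le2 : n./2 <= n by lia.
pose W := [set widen_ord le2 i | i in [set: 'I_(n./2)]].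
have cW : #|W| = n./2.
  by rewrite card_imset ?cardsT ?card_ord // => i j /(congr1 val) /= /val_inj.
have /set0Pn[z zW] : W != set0 by rewrite -card_gt0 cW; lia.
exists W, z; split=> //; first by rewrite cardsCs setCK card_ord cW; lia.
by move: (cardsD1 z W); rewrite zW cW add1n; set k := #|_|; lia.
Qed.

Lemma INR_expn2 k : INR (2 ^ k) = pow 2 k.
Proof.
elim: k => [//|k IHk]; rewrite expnS -multE mult_INR IHk /=.
by congr (Rmult _ _).
Qed.

Lemma exp_pow_INR x k : exp (Rmult (INR k) x) = pow (exp x) k.
Proof.
elim: k => [|k IHk]; first by rewrite Rmult_0_l exp_0.
by rewrite S_INR Rmult_plus_distr_r Rmult_1_l exp_plus IHk Rmult_comm.
Qed.

Theorem mainTheorem4 :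
  exists (c C : R) (n0 : nat),
    Rlt 0 c /\ Rlt c C /\
    forall n : nat, (n0 <= n)%N ->
      Rle (exp (Ropp (Rmult C (INR n)))) (prob_not_even_degenerate n) /\
      Rle (prob_not_even_degenerate n) (exp (Ropp (Rmult c (INR n)))).
Proof.
exists (Rinv (IZR 4096)), (IZR 2), (8 * 1024); split; first by lra.
split; first by lra.
move=> n le_n; rewrite /prob_not_even_degenerate.
set ND := #|_|; set N := #|graphs n|.
have N_gt0 : Rlt 0 (INR N).
  by apply: lt_0_INR; apply/ltP; rewrite /N /graphs card_powerset expn_gt0.
split.
  have lt0 : 0 < n by lia.
  have lt1 : 1 < n by lia.
  have := @card_not_even_degenerate_ge n (Ordinal lt0) (Ordinal lt1).
  rewrite -/ND -/N => /(_ ltac:(lia) isT) /leP /le_INR.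
  rewrite -!multE !mult_INR INR_expn2 => leN.
  have e1 : Rle (pow 2 n) (exp (INR n)).
    rewrite -[INR n]Rmult_1_r exp_pow_INR; apply: pow_incr.
    by split; [lra | have := exp_ineq1_le 1; lra].
  have p2 : Rlt 0 (pow 2 n) by apply: pow_lt; lra.
  have -> : Ropp (Rmult 2 (INR n)) = Ropp (Rplus (INR n) (INR n)) by ring.
  rewrite exp_Ropp exp_plus.
  have ND0 := pos_INR ND.
  have ep := exp_pos (INR n).
  apply: (Rmult_le_reg_r (Rmult (exp (INR n)) (exp (INR n)))); first by nra.
  rewrite Rinv_l; last by nra.
  apply: (Rmult_le_reg_r (INR N)) => //.
  have -> : Rmult (Rmult (Rdiv (INR ND) (INR N)) (Rmult (exp (INR n)) (exp (INR n)))) (INR N)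
    = Rmult (INR ND) (Rmult (exp (INR n)) (exp (INR n))) by field; lra.
  have : Rle (Rmult (pow 2 n) (pow 2 n)) (Rmult (exp (INR n)) (exp (INR n))) by nra.
  by nra.
pose m := n %/ 1024.
have m_gt3 : 3 < m by rewrite /m; lia.
have [||W [z [zW l1 l2]]] := @exists_split n m; [by rewrite /m; lia | by lia |].
have := @card_not_even_degenerate_le n m W z zW _ l1 l2; rewrite -/ND -/N.
move=> /(_ ltac:(lia)) /leP /le_INR; rewrite -!multE !mult_INR INR_expn2 => leN.
have e2 : Rle (exp (/ 2)) 2.
  have := exp_le_3; have -> : IZR 1 = Rplus (/ 2) (/ 2) by lra.
  by rewrite exp_plus; have := exp_pos (/ 2); nra.
have ecn : Rle (Rmult 8 (exp (Rmult (/ 4096) (INR n)))) (pow 2 m).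
  have -> : m = 3 + (m - 3) by lia.
  rewrite -plusE pow_add; apply: Rmult_le_compat; try by [lra | apply: Rlt_le; apply: exp_pos].
  apply: (@Rle_trans _ (pow (exp (/ 2)) (m - 3))); last first.
    by apply: pow_incr; split=> //; apply: Rlt_le; apply: exp_pos.
  rewrite -exp_pow_INR.
  have : Rle (INR n) (INR (2048 * (m - 3))) by apply: le_INR; apply/leP; rewrite /m; lia.
  rewrite -multE mult_INR => le_nm.
  have h : Rle (Rmult (/ 4096) (INR n)) (Rmult (INR (m - 3)) (/ 2)).
    have e : INR 2048 = IZR 2048 by rewrite INR_IZR_INZ; congr IZR.
    by rewrite e in le_nm; lra.
  by case: h => [/exp_increasing/Rlt_le //|->]; apply: Rle_refl.
rewrite exp_Ropp.
have ep := exp_pos (Rmult (/ 4096) (INR n)); set x := exp _ in ecn ep *.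
apply: (Rmult_le_reg_r x) => //; rewrite Rinv_l; last by lra.
apply: (Rmult_le_reg_r (INR N)) => //.
have -> : Rmult (Rmult (Rdiv (INR ND) (INR N)) x) (INR N) = Rmult (INR ND) x by field; lra.
have ND0 := pos_INR ND.
have e7 : INR 7 = IZR 7 by rewrite /=; lra.
rewrite e7 in leN.
by nra.
Qed.
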